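(* Let $s>1$, let $\lambda,\kappa\in\mathbb R$, $t>0$, and let $\mathfrak F^{2d}_p$, $\mathfrak P^{2d}_p$ be the discretisation maps defined in the context. Assume that the real coefficients satisfy $$b_\alpha^{(i)}b_{\tilde\alpha}^{(j)}-b_\alpha^{(i)}a^{(j)}_{\alpha,\tilde\alpha}-b^{(j)}_{\tilde\alpha}a^{(i)}_{\tilde\alpha,\alpha}=0\qquad\text{for all }\alpha,\tilde\alpha\in D,\ i,j\in\{0,1\},$$ and that (almost surely) for all $u\in H^s(\mathbb T)$ and all $0\le p,q\le S$ $$\Re\int_{\mathbb T}\overline u\,\mathfrak F^{2d}_p(t;c_q;u)\,dx=0,\qquad\Re\int_{\mathbb T}\overline u\,\mathfrak P^{2d}_p(t;c_q;u)\,dx=0.$$ Let $u_n,u_{n+1},U_\alpha,K_\alpha,L_\alpha\in H^s(\mathbb T)$ ($\alpha\in D$) satisfy the stochastic Runge–Kutta scheme $$u_{n+1}=e^{it\partial_x^2}u_n+t\,e^{it\partial_x^2}\sum_{\alpha\in D}b^{(0)}_\alpha K_\alpha+\sqrt t\,e^{it\partial_x^2}\sum_{\alpha\in D}b^{(1)}_\alpha L_\alpha,$$ $$U_\alpha=u_n+t\sum_{\tilde\alpha\in D}a^{(0)}_{\alpha,\tilde\alpha}K_{\tilde\alpha}+\sqrt t\sum_{\tilde\alpha\in D}a^{(1)}_{\alpha,\tilde\alpha}L_{\tilde\alpha},\qquad K_\alpha=\mathfrak F^{2d}_p(t;c_q;U_\alpha),\quad L_\alpha=\mathfrak P^{2d}_p(t;c_q;U_\alpha)\quad(\alpha=(p,q,r)\in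 D).$$ Then the mass is conserved: $$\int_{\mathbb T}|u_{n+1}|^2\,dx=\int_{\mathbb T}|u_n|^2\,dx\quad\text{a.s.}$$
   Context: $\mathbb T$ is the one-dimensional torus, $u_k$ is the $k$-th Fourier coefficient of $u$. $D=\{(p,q,r)\in\mathbb N_0^3:0\le p,q,r\le S\}$ for a fixed $S\in\mathbb N_0$; $c_0,\dots,c_S\in[0,1]$; $a^{(i)}_{\alpha,\tilde\alpha},b^{(i)}_\alpha\in\mathbb R$ for $\alpha,\tilde\alpha\in D$, $i=0,1$. Noise: $(W_k)_{k\in\mathbb Z}$ are real-valued standard Brownian motions with $W_{-k}=\overline{W_k}=W_k$, independent for distinct $k\ge0$; $\Phi$ is a Hilbert–Schmidt operator $L^2(\mathbb T)\to H^2(\mathbb T)$, diagonal in Fourier space with coefficients $\Phi_k$. Stratonovich integrals ($\circ\, dW$) of deterministic integrands are ordinary Wiener integrals. At step $n$ of the scheme $W_k(s)$ is replaced by the increment $W_k(nt+s)-W_k(nt)$. Interpolation: fix $d\ge1$ and distinct $0\le\gamma_1<\dots<\gamma_d\le1$; $P_d[f]$ is the unique polynomial of degree at most $d-1$ with $P_d[f](t\gamma_j)=f(t\gamma_j)$, $j=1,\dots,d$. Here $e^{i\,\cdot\,a}$ denotes $s\mapsto e^{isa}$. Kernel: $$\mathcal K_{2d}(s;k,k_1,k_2,k_3)=e^{-2iskk_1}P_d[e^{2i\cdot k_2k_3}](s)+e^{2isk_2k_3}P_d[e^{-2i\cdot kk_1}](s)-P_d[e^{2i\cdot k_2k_3}](s)\,P_d[e^{-2i\cdot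 kk_1}](s).$$ Discretisation maps: $$\mathfrak F^{2d}_p(t;c_q;v)=-i\lambda\sum_{k\in\mathbb Z}e^{ikx}\sum_{k+k_1=k_2+k_3}\frac1{t^{p+1}}\int_0^{c_qt}\mathcal K_{2d}(s;k,k_1,k_2,k_3)s^p\,ds\;\overline{v_{k_1}}v_{k_2}v_{k_3},$$ $$\mathfrak P^{2d}_p(t;c_q;v)=-i\kappa\sum_{k\in\mathbb Z}e^{ikx}\frac1{t^{p+\frac12}}\sum_{k=k_1+k_2}v_{k_1}\Phi_{k_2}\int_0^{c_qt}P_d[e^{i\cdot(kk_2+k_1k_2)}](s)\,s^p\circ dW_{k_2}(s).$$ *)

(* Defs.v *)
From HB Require Import structures.
From mathcomp Require Import all_boot all_order all_algebra.
From mathcomp Require Import all_classical all_reals all_analysis.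
From mathcomp Require Import measurable_realfun.
From mathcomp Require Import complex.

Set Implicit Arguments.
Unset Strict Implicit.
Unset Printing Implicit Defensive.

Import Order.TTheory GRing.Theory Num.Theory.
Import numFieldTopology.Exports numFieldNormedType.Exports.

Local Open Scope classical_set_scope.
Local Open Scope ring_scope.
Local Open Scope complex_scope.

Notation cmod := ComplexField.Normc.normc.

Section complex_analysis.
Context {R : realType}.
Implicit Types (D : set R) (y : R).

Definition expi y : R[i] := cos y +i* sin y.

Definition cintegral D (f : R -> R[i]) : R[i] :=
  (\int[lebesgue_measure]_(x in D) complex.Re (f x))
  +i* (\int[lebesgue_measure]_(x in D) complex.Im (f x)).

(* Sum of an absolutely summable family, irrespective of any ordering of the
   index set: positive part minus negative part. *)
Definition rsum {I : choiceType} (D : set I) (f : I -> R) : R :=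
  fine (\esum_(i in D) (f^\+ i)%:E) - fine (\esum_(i in D) (f^\- i)%:E).

Definition csum {I : choiceType} (D : set I) (f : I -> R[i]) : R[i] :=
  rsum D (fun i => complex.Re (f i)) +i* rsum D (fun i => complex.Im (f i)).

End complex_analysis.

(* The torus is R / 2 pi Z: its functions are the 2 pi-periodic functions on R,
   integrals are taken over the fundamental domain [0, 2 pi], and two functions
   that agree almost everywhere there are the same element of L^2. *)
Section torus.
Context {R : realType}.
Implicit Types (u v : R -> R[i]) (s t : R) (k : int).

Definition torus : set R := `[0, 2 * pi].

Definition eqT u v := u = v %[ae (@lebesgue_measure R) in torus].

Definition fourier u k : R[i] :=
  ((2 * pi)^-1)%:C * cintegral torus (fun x => u x * expi (- (k%:~R * x))).

Definition mass u : \bar R :=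
  (\int[lebesgue_measure]_(x in torus) (cmod (u x) ^+ 2)%:E)%E.

Definition L2T u : Prop :=
  [/\ periodic u (2 * pi),
      measurable_fun torus (fun x => complex.Re (u x)),
      measurable_fun torus (fun x => complex.Im (u x)) &
      (mass u < +oo)%E].

Definition sobolev_norm2 s u : \bar R :=
  (\esum_(k in [set: int])
     ((1 + (k%:~R : R) ^+ 2) `^ s * cmod (fourier u k) ^+ 2)%:E)%R.

Definition HT s u : Prop := L2T u /\ (sobolev_norm2 s u < +oo)%E.

Definition fourier_series (w : int -> R[i]) : R -> R[i] :=
  fun x => csum [set: int] (fun k => expi (k%:~R * x) * w k).

(* The free Schroedinger group: Fourier multiplier e^{-itk^2}. *)
Definition schroedinger t u : R -> R[i] :=
  fourier_series (fun k => expi (- (t * k%:~R ^+ 2)) * fourier u k).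

(* e_k / sqrt(2 pi) is the orthonormal basis of L^2 over [0, 2 pi] with dx. *)
Definition onb k : R -> R[i] := fun x => ((Num.sqrt (2 * pi))^-1)%:C * expi (k%:~R * x).

Definition hilbert_schmidt_diag s (Phi : (R -> R[i]) -> R -> R[i])
    (phi : int -> R[i]) : Prop :=
  [/\ (forall f, L2T f -> HT s (Phi f)) /\
      (forall f g, L2T f -> L2T g -> eqT f g -> eqT (Phi f) (Phi g)),
      (forall (z : R[i]) f g, L2T f -> L2T g ->
         eqT (Phi (fun x => z * f x + g x)) (fun x => z * Phi f x + Phi g x)),
      (exists C : R, forall f, L2T f -> (sobolev_norm2 s (Phi f) <= C%:E * mass f)%E),
      (\esum_(k in [set: int]) sobolev_norm2 s (Phi (onb k)) < +oo)%E &
      (forall f k, L2T f -> fourier (Phi f) k = phi k * fourier f k)].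

End torus.

Section noise.
Context d {Omega : measurableType d} {R : realType} (P : probability Omega R).
Implicit Types (B : R -> {RV P >-> R}) (W : int -> R -> {RV P >-> R}).

(* Mutual independence of the set systems F i, i in D. *)
Definition independent_systems {I : choiceType} (D : set I)
    (F : I -> set (set Omega)) : Prop :=
  forall (J : seq I) (A : I -> set Omega), uniq J ->
    (forall j, j \in J -> D j /\ F j (A j)) ->
    P (\bigcap_(j in [set` J]) A j) = (\prod_(j <- J) fine (P (A j)))%:E.

Definition sigma_of (X : {RV P >-> R}) : set (set Omega) :=
  preimage_set_system setT X measurable.

Definition sigma_of_process B : set (set Omega) :=
  <<s \bigcup_(t in `[0, +oo[) sigma_of (B t) >>.

Definition increment B (r s : R) : {RV P >-> R} :=
  (B s : {mfun Omega >-> R}) - B r.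

Definition standard_brownian_motion B : Prop :=
  [/\ {ae P, forall w, B 0 w = 0},
      (forall tau : nat -> R, 0 <= tau 0%N ->
         {homo tau : i j / (i <= j)%N >-> i <= j} ->
         independent_systems [set: nat]
           (fun i => sigma_of (increment B (tau i) (tau i.+1)))),
      (forall r s : R, 0 <= r < s ->
         distribution P (increment B r s) = normal_prob 0 (Num.sqrt (s - r))
           :> (set R -> \bar R)) &
      {ae P, forall w, {within `[0, +oo[, continuous (fun s => B s w)}}].

Definition brownian_family W : Prop :=
  [/\ (forall k, standard_brownian_motion (W k)),
      (forall k s w, W (- k) s w = W k s w) &
      independent_systems [set k : int | 0 <= k] (fun k => sigma_of_process (W k))].

(* A step function sum_j c_j 1_]a_j, b_j] is the list of the ((a_j, b_j), c_j). *)
Definition step_fun (h : seq (R * R * R)) (x : R) : R :=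
  \sum_(j <- h) j.2 * \1_`]j.1.1, j.1.2] x.

Definition step_integral B (h : seq (R * R * R)) (w : Omega) : R :=
  \sum_(j <- h) j.2 * (B j.1.2 w - B j.1.1 w).

(* I is a version of int_0^T f dB: the L^2(P)-limit of the integrals of step
   functions converging to f in L^2(0, T). *)
Definition is_wiener_integral B (T : R) (f : R -> R) (I : {RV P >-> R}) : Prop :=
  exists h : nat -> seq (R * R * R),
    [/\ (forall n, all (fun j => [&& 0 <= j.1.1, j.1.1 <= j.1.2 & j.1.2 <= T]) (h n)),
        (fun n => \int[lebesgue_measure]_(x in `[0%R, T])
           ((f x - step_fun (h n) x) ^+ 2)%:E)%E @ \oo --> 0%E &
        (fun n => \int[P]_w ((step_integral B (h n) w - I w) ^+ 2)%:E)%E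
           @ \oo --> 0%E].

Definition wiener_integral B (T : R) (f : R -> R) : {RV P >-> R} :=
  xget (0 : {mfun Omega >-> R}) [set I | is_wiener_integral B T f I].

Definition cwiener_integral B (T : R) (f : R -> R[i]) (w : Omega) : R[i] :=
  wiener_integral B T (fun s => complex.Re (f s)) w
  +i* wiener_integral B T (fun s => complex.Im (f s)) w.

Definition step_noise (t : R) (n : nat) W (k : int) (s : R) : {RV P >-> R} :=
  increment (W k) (n%:R * t) (n%:R * t + s).

End noise.

(* The triples (p, q, r) of natural numbers at most S. *)
Notation stage S := ('I_S.+1 * 'I_S.+1 * 'I_S.+1)%type.

Section discretisation.
Context {R : realType} {d : nat} (gamma : 'I_d -> R) (t : R).

(* The polynomial P_d[f] of degree at most d - 1; it exists and is unique as soon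
   as the nodes t * gamma j are distinct. *)
Definition interp (f : R -> R[i]) : {poly R[i]} :=
  xget 0 [set p : {poly R[i]} | (size p <= d)%N /\
                  forall j : 'I_d, p.[(t * gamma j)%:C] = f (t * gamma j)].

Lemma interpP (f : R -> R[i]) : injective (fun j => t * gamma j) ->
  [/\ (size (interp f) <= d)%N,
      forall j : 'I_d, (interp f).[(t * gamma j)%:C] = f (t * gamma j) &
      forall p : {poly R[i]}, (size p <= d)%N ->
        (forall j : 'I_d, p.[(t * gamma j)%:C] = f (t * gamma j)) ->
        p = interp f].
Proof.
move=> tg_inj.
pose x (j : 'I_d) : R[i] := (t * gamma j)%:C.
have x_inj : injective x by move=> i j [/tg_inj].
pose l (j : 'I_d) : {poly R[i]} :=
  \prod_(i | i != j) ((x j - x i)^-1 *: ('X - (x i)%:P)).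
pose p : {poly R[i]} := \sum_j f (t * gamma j) *: l j.
have lE i j : (l j).[x i] = (i == j)%:R.
  rewrite horner_prod; have [->|ij] := eqVneq i j.
    rewrite big1// => k kj; rewrite !hornerE mulVf// subr_eq0.
    by apply: contra_neq kj => /x_inj.
  by rewrite (bigD1 i)//= !hornerE subrr mulr0 mul0r.
have size_l j : (size (l j) <= d)%N.
  have cardP : #|[pred i : 'I_d | i != j]|.+1 = d.
    by rewrite -[RHS]card_ord [RHS](cardD1 j) inE add1n; congr _.+1;
      apply: eq_card => k; rewrite !inE andbT.
  rewrite -[X in (_ <= X)%N]cardP (leq_trans (size_poly_prod_leq _ _))//.
  rewrite leq_subLR addnS ltnS addnn -muln2 -sum_nat_const.
  apply: leq_sum => i _.
  by rewrite (leq_trans (size_scale_leq _ _))// size_XsubC.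
have [sI eI] : (size (interp f) <= d)%N /\
    forall j : 'I_d, (interp f).[x j] = f (t * gamma j).
  apply: (@xgetPex _ 0 [set p : {poly R[i]} | (size p <= d)%N /\
    forall j : 'I_d, p.[x j] = f (t * gamma j)]).
  exists p; split=> [|j].
    by apply: (leq_trans (size_sum _ _ _)); apply/bigmax_leqP => j _;
      exact: leq_trans (size_scale_leq _ _) (size_l j).
  rewrite horner_sum (bigD1 j)//= hornerZ lE eqxx mulr1 big1 ?addr0// => i ij.
  by rewrite hornerZ lE eq_sym (negbTE ij) mulr0.
split=> // q sq eq; apply/eqP; rewrite -subr_eq0; apply/eqP.
apply: (@roots_geq_poly_eq0 _ _ [seq x j | j <- enum 'I_d]).
- by apply/allP => _ /mapP[j _ ->]; rewrite /root !hornerE eq eI subrr.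
- by rewrite map_inj_uniq ?enum_uniq.
- by rewrite size_map size_enum_ord (leq_trans (size_polyD _ _))// size_polyN geq_max sq.
Qed.

Definition interp_exp (a : int) (s : R) : R[i] :=
  (interp (fun s' => expi (s' * a%:~R))).[s%:C].

Definition kernel2 (s : R) (k k1 k2 k3 : int) : R[i] :=
  expi (s * (- (2 * (k * k1)))%:~R) * interp_exp (2 * (k2 * k3)) s
  + expi (s * (2 * (k2 * k3))%:~R) * interp_exp (- (2 * (k * k1))) s
  - interp_exp (2 * (k2 * k3)) s * interp_exp (- (2 * (k * k1))) s.

(* c stands for c_q; the index of the inner sum is (k1, k2, k3). *)
Definition discF (lambda : R) (p : nat) (c : R) (v : R -> R[i]) : R -> R[i] :=
  fun x => - 'i%C * lambda%:C *
  fourier_series (fun k =>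
    csum [set l : int * int * int | k + l.1.1 = l.1.2 + l.2]
      (fun l => let: (k1, k2, k3) := l in
         ((t ^+ p.+1)^-1)%:C
         * cintegral `[0, c * t] (fun s => kernel2 s k k1 k2 k3 * (s ^+ p)%:C)
         * (fourier v k1)^*%C * fourier v k2 * fourier v k3)) x.

Definition discP {d'} {Omega : measurableType d'} {P : probability Omega R}
    (B : int -> R -> {RV P >-> R}) (phi : int -> R[i]) (kappa : R)
    (p : nat) (c : R) (w : Omega) (v : R -> R[i]) : R -> R[i] :=
  fun x => - 'i%C * kappa%:C *
  fourier_series (fun k => ((t `^ (p%:R + 2^-1))^-1)%:C *
    csum [set l : int * int | k = l.1 + l.2]
      (fun l => let: (k1, k2) := l in
         fourier v k1 * phi k2
         * cwiener_integral (B k2) (c * t)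
             (fun s => interp_exp (k * k2 + k1 * k2) s * (s ^+ p)%:C) w)) x.

End discretisation.

(* Main.v *)
(* Pathwise, put X_(0,alpha) = t K_alpha and X_(1,alpha) = sqrt t L_alpha, so that
   U_alpha = u_n + sum_y a_y X_y.  The mass assumptions say that U_alpha is orthogonal
   to X_(0,alpha) and X_(1,alpha) for the real inner product <.,.>, which expresses
   <u_n, X_x> through the Gram matrix <X_y, X_x>.  Expanding the square norm of
   V = u_n + sum_x b_x X_x then leaves |u_n|^2 plus a sum over pairs whose
   coefficients are those of the algebraic condition.  Finally u_(n+1) is the
   Schroedinger evolution of V, which preserves the mass by Parseval.

   Parseval is needed for functions with absolutely summable Fourier coefficients.
   It rests on the uniqueness of Fourier coefficients: a function orthogonal to all
   trigonometric polynomials is orthogonal to the indicator of every small arc, a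
   bounded a.e. limit of polynomials in cos (x - x0), and hence vanishes at each of
   its Lebesgue points. *)

Require Import Defs.
From HB Require Import structures.
From mathcomp Require Import all_boot all_order all_algebra.
From mathcomp Require Import all_classical all_reals all_analysis.
From mathcomp Require Import measurable_realfun.
From mathcomp Require Import complex.
From mathcomp Require Import ring lra.

Set Implicit Arguments.
Unset Strict Implicit.
Unset Printing Implicit Defensive.

Import Order.TTheory GRing.Theory Num.Theory.
Import numFieldTopology.Exports numFieldNormedType.Exports.

Local Open Scope classical_set_scope.
Local Open Scope ring_scope.
Local Open Scope complex_scope.

(** * Real and imaginary parts of complex arithmetic *)

Lemma ReD (R : realType) (z w : R[i]) :
  complex.Re (z + w) = complex.Re z + complex.Re w.
Proof. by case: z w => [? ?] [? ?]. Qed.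

Lemma ImD (R : realType) (z w : R[i]) :
  complex.Im (z + w) = complex.Im z + complex.Im w.
Proof. by case: z w => [? ?] [? ?]. Qed.

Lemma ReM (R : realType) (z w : R[i]) :
  complex.Re (z * w) = complex.Re z * complex.Re w - complex.Im z * complex.Im w.
Proof. by case: z w => [? ?] [? ?]. Qed.

Lemma ImM (R : realType) (z w : R[i]) :
  complex.Im (z * w) = complex.Re z * complex.Im w + complex.Im z * complex.Re w.
Proof. by case: z w => [? ?] [? ?]. Qed.

Lemma ReZ (R : realType) (r : R) (z : R[i]) :
  complex.Re (r%:C * z) = r * complex.Re z.
Proof. by rewrite ReM /= mul0r subr0. Qed.

Lemma ImZ (R : realType) (r : R) (z : R[i]) :
  complex.Im (r%:C * z) = r * complex.Im z.
Proof. by rewrite ImM /= mul0r addr0. Qed.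

Lemma Re_sum (R : realType) (I : Type) (r : seq I) (F : I -> R[i]) :
  complex.Re (\sum_(i <- r) F i) = \sum_(i <- r) complex.Re (F i).
Proof. exact: (big_morph _ (@ReD R) erefl). Qed.

Lemma Im_sum (R : realType) (I : Type) (r : seq I) (F : I -> R[i]) :
  complex.Im (\sum_(i <- r) F i) = \sum_(i <- r) complex.Im (F i).
Proof. exact: (big_morph _ (@ImD R) erefl). Qed.

(** * Square-integrable functions on the torus and their real inner product *)

Section real_inner_product.
Context {R : realType}.
Local Notation mu := (@lebesgue_measure R).
Implicit Types (f g : R -> R) (u v : R -> R[i]).

(* Ascribed to [measurableTypeR R]: Lebesgue measure does not live on the default
   measurable structure of [R], and unification fails between the two. *)
Lemma measurable_torus : measurable (torus : set (measurableTypeR R)).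
Proof. exact: measurable_itv. Qed.

Lemma mu_torus : mu torus = (2 * pi)%:E.
Proof.
by rewrite lebesgue_measure_itv/= lte_fin mulr_gt0 ?pi_gt0//= oppr0 adde0.
Qed.

Lemma bounded_integrable_torus f (M : R) : measurable_fun torus f ->
  (forall x, torus x -> `|f x| <= M) -> mu.-integrable torus (EFin \o f).
Proof.
move=> mf fM; apply: measurable_bounded_integrable => //.
- exact: measurable_torus.
- by rewrite [X in (X < _)%E]mu_torus ltry.
- exists M; split; first exact: num_real.
  by move=> N MN x /= xT; rewrite (le_trans (fM _ xT))// ltW.
Qed.

Lemma integrable_torusZ (r : R) f : mu.-integrable torus (EFin \o f) ->
  mu.-integrable torus (EFin \o (fun x => r * f x)).
Proof.
move=> /(integrableZl measurable_torus r); apply: eq_integrable => //.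
exact: measurable_torus.
Qed.

Lemma integrable_torusD f g : mu.-integrable torus (EFin \o f) ->
  mu.-integrable torus (EFin \o g) ->
  mu.-integrable torus (EFin \o (fun x => f x + g x)).
Proof. by move=> fi gi; exact: (integrableD measurable_torus fi gi). Qed.

#[global] Instance ae_torus_filter : Filter (almost_everywhere mu).
Proof. exact: (ae_filter_ringOfSetsType mu). Qed.

Lemma ae_torusS (A B : R -> Prop) : (forall x, A x -> B x) ->
  {ae mu, forall x, A x} -> {ae mu, forall x, B x}.
Proof. exact: filterS. Qed.

Definition square_integrable f :=
  measurable_fun torus f /\ mu.-integrable torus (EFin \o (fun x => f x ^+ 2)).

(** The product is dominated by [f ^+ 2 + g ^+ 2]. *)
Lemma square_integrableM f g : square_integrable f -> square_integrable g ->
  mu.-integrable torus (EFin \o (fun x => f x * g x)).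
Proof.
move=> [mf if2] [mg ig2].
apply: (le_integrable measurable_torus _ _
  (integrableD measurable_torus if2 ig2)).
  by apply/measurable_EFinP; exact: measurable_funM.
move=> x _ /=; rewrite lee_fin [leRHS]ger0_norm ?addr_ge0 ?sqr_ge0//.
by rewrite ler_norml; apply/andP; split; nra.
Qed.

Lemma bounded_square_integrable f (M : R) : measurable_fun torus f ->
  (forall x, torus x -> `|f x| <= M) -> square_integrable f.
Proof.
move=> mf fM; split=> //.
apply: (@bounded_integrable_torus _ (M ^+ 2)); first exact: measurable_funX.
move=> x xT; rewrite normrX lerXn2r ?nnegrE ?fM//.
by rewrite (le_trans _ (fM _ xT)).
Qed.

(** The torus has finite measure, so the constant 1 is a square-integrable factor. *)
Lemma square_integrable_torus (f : R -> R) : square_integrable f ->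
  mu.-integrable torus (EFin \o f).
Proof.
move=> f2; have c2 : square_integrable (cst 1 : R -> R).
  by apply: (@bounded_square_integrable _ 1) => // x _; rewrite normr1.
have := square_integrableM f2 c2.
by under eq_fun do rewrite /= mulr1.
Qed.

Lemma square_integrableD f g : square_integrable f -> square_integrable g ->
  square_integrable (fun x => f x + g x).
Proof.
move=> f2 g2; have ifg := square_integrableM f2 g2.
case: f2 g2 => [mf if2] [mg ig2]; split; first exact: measurable_funD.
apply: (le_integrable measurable_torus _ _
  (integrableZl measurable_torus 2 (integrableD measurable_torus if2 ig2))).
  by apply/measurable_EFinP; apply: measurable_funX; exact: measurable_funD.
move=> x _ /=; rewrite lee_fin !ger0_norm ?sqr_ge0 ?mulr_ge0 ?addr_ge0 ?sqr_ge0//.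
rewrite -subr_ge0.
(* The parallelogram identity: [2 (f^2 + g^2)] exceeds [(f + g)^2] by exactly [(f - g)^2]. *)
rewrite [leRHS](_ : _ = (f x - g x) ^+ 2) ?sqr_ge0//; ring.
Qed.

Lemma square_integrableZ (r : R) f : square_integrable f ->
  square_integrable (fun x => r * f x).
Proof.
move=> [mf if2]; split; first exact: measurable_funM.
by under eq_fun do rewrite exprMn; exact: integrable_torusZ.
Qed.

Definition L2c u :=
  square_integrable (fun x => complex.Re (u x)) /\
  square_integrable (fun x => complex.Im (u x)).

(* The real part of the Hermitian product: all coefficients of the scheme are real. *)
Definition ip u v : R := \int[mu]_(x in torus)
  (complex.Re (u x) * complex.Re (v x) + complex.Im (u x) * complex.Im (v x)).

Lemma ip_integrable u v : L2c u -> L2c v -> mu.-integrable torus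
  (EFin \o (fun x => complex.Re (u x) * complex.Re (v x)
                     + complex.Im (u x) * complex.Im (v x))).
Proof.
move=> [ru iu] [rv iv].
exact: (integrableD measurable_torus (square_integrableM ru rv)
  (square_integrableM iu iv)).
Qed.

Lemma ipC u v : ip u v = ip v u.
Proof. by apply: eq_Rintegral => x _; rewrite !(mulrC (_ (u x))). Qed.

Lemma L2c0 : L2c (fun=> 0).
Proof.
have h : square_integrable (fun=> 0).
  by apply: (@bounded_square_integrable _ 0) => // x _; rewrite normr0.
by split.
Qed.

Lemma L2cD u v : L2c u -> L2c v -> L2c (fun x => u x + v x).
Proof.
move=> [ru iu] [rv iv]; split.
  by under eq_fun do rewrite ReD; exact: square_integrableD.
by under eq_fun do rewrite ImD; exact: square_integrableD.
Qed.

Lemma L2cZ (r : R) u : L2c u -> L2c (fun x => r%:C * u x).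
Proof.
move=> [ru iu]; split.
  by under eq_fun do rewrite ReZ; exact: square_integrableZ.
by under eq_fun do rewrite ImZ; exact: square_integrableZ.
Qed.

Lemma L2c_sum (I : Type) (s : seq I) (u : I -> R -> R[i]) :
  (forall i, L2c (u i)) -> L2c (fun x => \sum_(i <- s) u i x).
Proof.
move=> hu; elim: s => [|i s ih].
  by under eq_fun do rewrite big_nil; exact: L2c0.
by under eq_fun do rewrite big_cons; exact: L2cD.
Qed.

Lemma ipDl u u' v : L2c u -> L2c u' -> L2c v ->
  ip (fun x => u x + u' x) v = ip u v + ip u' v.
Proof.
move=> hu hu' hv; rewrite -RintegralD; first last.
- exact: ip_integrable.
- exact: ip_integrable.
- exact: measurable_torus.
- by apply: eq_Rintegral => x _; rewrite ReD ImD; ring.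
Qed.

Lemma ipZl (r : R) u v : L2c u -> L2c v ->
  ip (fun x => r%:C * u x) v = r * ip u v.
Proof.
move=> hu hv; rewrite -RintegralZl; first last.
- exact: ip_integrable.
- exact: measurable_torus.
- by apply: eq_Rintegral => x _; rewrite ReZ ImZ; ring.
Qed.

Lemma ip0l v : ip (fun=> 0) v = 0.
Proof.
rewrite /ip; under eq_Rintegral do rewrite !mul0r addr0.
by rewrite /Rintegral integral0.
Qed.

Lemma ip_suml (I : Type) (s : seq I) (u : I -> R -> R[i]) v :
  (forall i, L2c (u i)) -> L2c v ->
  ip (fun x => \sum_(i <- s) u i x) v = \sum_(i <- s) ip (u i) v.
Proof.
move=> hu hv; elim: s => [|i s ih].
  by rewrite big_nil -[RHS](ip0l v); congr ip; apply/funext=> x; rewrite big_nil.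
rewrite big_cons -ih -ipDl//; last exact: L2c_sum.
by congr ip; apply/funext=> x; rewrite big_cons.
Qed.

(** Weaker than [L2c] on purpose: of a discretisation map applied to a stage only measurability is
    established, and [ip_ae] has to accept it as an argument. *)
Definition torus_measurable u :=
  measurable_fun torus (fun x => complex.Re (u x)) /\
  measurable_fun torus (fun x => complex.Im (u x)).

Lemma L2c_measurable u : L2c u -> torus_measurable u.
Proof. by move=> [[mr _] [mi _]]. Qed.

Lemma ip_ae u u' v : torus_measurable u -> torus_measurable u' ->
  torus_measurable v -> eqT u u' -> ip u v = ip u' v.
Proof.
move=> [ru iu] [ru' iu'] [rv iv] uu'; congr fine; apply: ae_eq_integral.
- exact: measurable_torus.
- by apply/measurable_EFinP; apply: measurable_funD; exact: measurable_funM.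
- by apply/measurable_EFinP; apply: measurable_funD; exact: measurable_funM.
- by apply: ae_torusS uu' => x h /h ->.
Qed.

Lemma sqr_cmod (z : R[i]) :
  cmod z ^+ 2 = complex.Re z ^+ 2 + complex.Im z ^+ 2.
Proof. by case: z => a b; rewrite /= sqr_sqrtr// addr_ge0 ?sqr_ge0. Qed.

Lemma mass_ae u u' : torus_measurable u -> torus_measurable u' ->
  eqT u u' -> mass u = mass u'.
Proof.
have mm v : torus_measurable v ->
    measurable_fun torus (EFin \o (fun x => cmod (v x) ^+ 2)).
  move=> [rv iv]; apply/measurable_EFinP; under eq_fun do rewrite sqr_cmod.
  by apply: measurable_funD; exact: measurable_funX.
move=> hu hu' uu'; apply: ae_eq_integral.
- exact: measurable_torus.
- exact: mm.
- exact: mm.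
- by apply: ae_torusS uu' => x h /h ->.
Qed.

Lemma mass_ip u : L2c u -> mass u = (ip u u)%:E.
Proof.
move=> hu; rewrite fineK.
  by apply: eq_integral => x _; rewrite sqr_cmod !expr2.
by apply: integrable_fin_num; [exact: measurable_torus|exact: ip_integrable].
Qed.

Lemma L2T_L2c u : L2T u -> L2c u.
Proof.
move=> [_ mr mi fm].
have i2 : mu.-integrable torus (EFin \o (fun x => cmod (u x) ^+ 2)).
  apply/integrableP; split.
    apply/measurable_EFinP; under eq_fun do rewrite sqr_cmod.
    by apply: measurable_funD; exact: measurable_funX.
  apply: le_lt_trans fm; rewrite le_eqVlt; apply/orP; left; apply/eqP.
  by apply: eq_integral => x _; rewrite /= ger0_norm// sqr_ge0.
split; split=> //.
  apply: (le_integrable measurable_torus _ _ i2).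
    by apply/measurable_EFinP; exact: measurable_funX.
  by move=> x _; rewrite /= lee_fin sqr_cmod !ger0_norm ?addr_ge0 ?sqr_ge0// lerDl sqr_ge0.
apply: (le_integrable measurable_torus _ _ i2).
  by apply/measurable_EFinP; exact: measurable_funX.
by move=> x _; rewrite /= lee_fin sqr_cmod !ger0_norm ?addr_ge0 ?sqr_ge0// lerDr sqr_ge0.
Qed.

End real_inner_product.

(** * Trigonometric integrals and orthogonality to polynomials in a shifted cosine *)

Section trigonometry.
Context {R : realType}.
Local Notation mu := (@lebesgue_measure R).
Implicit Types (f g : R -> R) (k : int).

Lemma sinD2piz k (x : R) : sin (x + k%:~R * (2 * pi)) = sin x.
Proof.
have hn (n : nat) (y : R) : sin (y + n%:R * (2 * pi)) = sin y.
  by rewrite !mulr_natl periodicn//; exact: sinD2pi.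
case: k => n; first exact: hn.
(* A negative number of periods: apply the natural case at the already shifted point. *)
by rewrite NegzE mulrNz mulNr -[LHS](hn n.+1) subrK.
Qed.

Lemma continuous_cos_affine (a b : R) : continuous (fun x : R => cos (a * x + b)).
Proof.
move=> x; apply: continuous_comp; last exact: continuous_cos.
by apply: continuousD; [exact: mulrl_continuous|exact: cst_continuous].
Qed.

Lemma measurable_cos_affine (D : set R) (a b : R) :
  measurable_fun D (fun x : R => cos (a * x + b)).
Proof.
apply: measurable_funTS; apply: continuous_measurable_fun.
exact: continuous_cos_affine.
Qed.

(** The antiderivative [sin (k x + b) / k] takes equal values at 0 and [2 * pi], because [k] is an
    integer. *)
Lemma integral_cos_affine k (b : R) : k != 0 ->
  \int[mu]_(x in torus) cos (k%:~R * x + b) = 0.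
Proof.
move=> k0; have kR0 : k%:~R != 0 :> R by rewrite intr_eq0.
pose F (x : R) := (k%:~R)^-1 * sin (k%:~R * x + b).
have dF (x : R) : is_derive x 1 F (cos (k%:~R * x + b)).
  rewrite /F; apply: is_derive_eq.
  by rewrite addr0 /GRing.scale/= mulr1 mulrC mulfK.
rewrite /Rintegral /torus (@continuous_FTC2 _ _ F).
- rewrite -EFinB /= /F mulr0 add0r [_ * (2 * pi) + b]addrC sinD2piz.
  exact: subrr.
- by rewrite mulr_gt0// pi_gt0.
- by apply: continuous_subspaceT => x; exact: continuous_cos_affine.
- split.
  + by move=> x _; exact: (@ex_derive _ _ _ _ _ _ _ (dF x)).
  + apply: cvg_at_right_filter; apply: differentiable_continuous.
    by apply/derivable1_diffP; exact: (@ex_derive _ _ _ _ _ _ _ (dF _)).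
  + apply: cvg_at_left_filter; apply: differentiable_continuous.
    by apply/derivable1_diffP; exact: (@ex_derive _ _ _ _ _ _ _ (dF _)).
- by move=> x _; rewrite derive1E; exact: (@derive_val _ _ _ _ _ _ _ (dF x)).
Qed.

Lemma integral_cos_affine_kron k (b : R) :
  \int[mu]_(x in torus) cos (k%:~R * x + b) = (k == 0)%:R * (2 * pi) * cos b.
Proof.
have [->|k0] := eqVneq; last by rewrite integral_cos_affine ?mul0r.
under eq_Rintegral do rewrite mul0r add0r.
rewrite Rintegral_cst; last exact: measurable_itv.
by rewrite [X in fine X]mu_torus mul1r mulrC.
Qed.

Lemma measurable_fun_horner (D : set R) f (p : {poly R}) :
  measurable_fun D f -> measurable_fun D (fun x => p.[f x]).
Proof.
move=> mf; under eq_fun do rewrite horner_coef.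
apply: measurable_sum => i; apply: measurable_funM => //.
exact: measurable_funX.
Qed.

Lemma integrable_mul_bounded f g (M : R) : mu.-integrable torus (EFin \o f) ->
  measurable_fun torus g -> (forall x, torus x -> `|g x| <= M) ->
  mu.-integrable torus (EFin \o (fun x => f x * g x)).
Proof.
move=> fi mg gM; have /measurable_EFinP mf := measurable_int _ fi.
apply: (le_integrable measurable_torus _ _
  (integrableZl measurable_torus M fi)).
  by apply/measurable_EFinP; exact: measurable_funM.
move=> x xT /=; rewrite lee_fin normrM [leRHS]normrM mulrC.
by rewrite ler_wpM2r// (le_trans (gM x xT))// ler_norm.
Qed.

(** Induction on the power: a factor [cos (x - x0)] turns into two cosines of frequencies [k + 1]
    and [k - 1] with shifted phases, so frequency and phase stay universally quantified. The base
    case is the addition formula. *)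
Lemma integral_mul_cosX_eq0 f (x0 : R) : mu.-integrable torus (EFin \o f) ->
  (forall k, \int[mu]_(x in torus) (f x * cos (k%:~R * x)) = 0) ->
  (forall k, \int[mu]_(x in torus) (f x * sin (k%:~R * x)) = 0) ->
  forall (m : nat) k (b : R),
  \int[mu]_(x in torus) (f x * (cos (x - x0) ^+ m * cos (k%:~R * x + b))) = 0.
Proof.
move=> fi fcos fsin.
have mcos (a b : R) : measurable_fun torus (fun x => cos (a * x + b)).
  exact: measurable_cos_affine.
have icos (r : R) (a b : R) :
    mu.-integrable torus (EFin \o (fun x => f x * (r * cos (a * x + b)))).
  apply: (integrable_mul_bounded (M := `|r|) fi); first exact: measurable_funM.
  by move=> x _; rewrite normrM ler_piMr ?cos_max.
have mcm (m : nat) : measurable_fun torus (fun x : R => cos (x - x0) ^+ m).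
  apply: measurable_funX.
  by under eq_fun do rewrite -[X in X - x0]mul1r; exact: mcos.
have cm1 (m : nat) (x : R) : `|cos (x - x0) ^+ m| <= 1.
  by rewrite normrX exprn_ile1 ?cos_max.
have icm m k (b : R) : mu.-integrable torus
    (EFin \o (fun x => f x * (cos (x - x0) ^+ m * cos (k%:~R * x + b)))).
  apply: (integrable_mul_bounded (M := 1) fi); first exact: measurable_funM.
  by move=> x _; rewrite normrM mulr_ile1 ?cos_max ?cm1.
elim=> [|m ih] k b.
  transitivity (\int[mu]_(x in torus) (cos b * (f x * cos (k%:~R * x)) +
                                        - sin b * (f x * sin (k%:~R * x)))).
    by apply: eq_Rintegral => x _; rewrite expr0 mul1r cosD; ring.
  have fci : mu.-integrable torus (EFin \o (fun x => f x * cos (k%:~R * x))).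
    have := icos 1 k%:~R 0; apply: eq_integrable; first exact: measurable_torus.
    by move=> x _ /=; rewrite mul1r addr0.
  have fsi : mu.-integrable torus (EFin \o (fun x => f x * sin (k%:~R * x))).
    have := icos 1 k%:~R (- (pi / 2)); apply: eq_integrable; first exact: measurable_torus.
    by move=> x _ /=; rewrite mul1r cosBpihalf.
  rewrite RintegralD; last 3 first.
  - exact: measurable_torus.
  - exact: integrable_torusZ fci.
  - exact: integrable_torusZ fsi.
  rewrite !RintegralZl ?fcos ?fsin ?mulr0 ?addr0//; exact: measurable_torus.
transitivity (\int[mu]_(x in torus)
    (2^-1 * (f x * (cos (x - x0) ^+ m * cos ((k + 1)%:~R * x + (b - x0)))) +
     2^-1 * (f x * (cos (x - x0) ^+ m * cos ((k - 1)%:~R * x + (b + x0)))))).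
  apply: eq_Rintegral => x _; rewrite exprSr.
  have -> : (k + 1)%:~R * x + (b - x0) = (k%:~R * x + b) + (x - x0).
    by rewrite intrD; ring.
  have -> : (k - 1)%:~R * x + (b + x0) = (k%:~R * x + b) - (x - x0).
    by rewrite intrD intrN; ring.
  by move: (x - x0) (_ + b) => y z; rewrite cosB cosD; field.
rewrite RintegralD; last 3 first.
- exact: measurable_torus.
- by apply: integrable_torusZ; exact: icm.
- by apply: integrable_torusZ; exact: icm.
rewrite !RintegralZl ?ih ?mulr0 ?addr0//; exact: measurable_torus.
Qed.

Lemma integral_mul_horner_cos_eq0 f (x0 : R) (p : {poly R}) :
  mu.-integrable torus (EFin \o f) ->
  (forall k, \int[mu]_(x in torus) (f x * cos (k%:~R * x)) = 0) ->
  (forall k, \int[mu]_(x in torus) (f x * sin (k%:~R * x)) = 0) ->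
  \int[mu]_(x in torus) (f x * p.[cos (x - x0)]) = 0.
Proof.
move=> fi fcos fsin.
have mcm (q : {poly R}) : measurable_fun torus (fun x : R => q.[cos (x - x0)]).
  apply: measurable_fun_horner.
  by under eq_fun do rewrite -[X in X - x0]mul1r; exact: measurable_cos_affine.
have hb (q : {poly R}) : exists M, forall x, torus x -> `|q.[cos (x - x0)]| <= M.
  exists (\sum_(i < size q) `|q`_i|) => x _; rewrite horner_coef.
  rewrite (le_trans (ler_norm_sum _ _ _))// ler_sum// => i _.
  by rewrite normrM ler_piMr// normrX exprn_ile1 ?cos_max.
have ih (q : {poly R}) :
    mu.-integrable torus (EFin \o (fun x => f x * q.[cos (x - x0)])).
  by have [M qM] := hb q; exact: integrable_mul_bounded fi (mcm q) qM.
rewrite (_ : (\int[mu]_(x in torus) (f x * p.[cos (x - x0)])) =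
  \int[mu]_(x in torus)
    (\sum_(i < size p) p`_i * (f x * cos (x - x0) ^+ i))); last first.
  apply: eq_Rintegral => x _; rewrite horner_coef mulr_sumr.
  by apply: eq_bigr => i _; rewrite mulrCA.
(* Induction on the number of monomials, carrying integrability along so that the integral of the
   sum splits. *)
pose s (n : nat) (x : R) := \sum_(i < n) p`_i * (f x * cos (x - x0) ^+ i).
have h (n : nat) : mu.-integrable torus (EFin \o s n) /\
    \int[mu]_(x in torus) s n x = 0.
  elim: n => [|n [IHi IH]].
    have -> : s 0 = cst 0 by apply/funext => x; rewrite /s big_ord0.
    by split; [exact: integrable0|rewrite /Rintegral integral0].
  have fc : mu.-integrable torus (EFin \o (fun x => f x * cos (x - x0) ^+ n)).
    by have := ih 'X^n; under eq_fun do rewrite hornerXn.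
  have -> : s n.+1 = (fun x => s n x + p`_n * (f x * cos (x - x0) ^+ n)).
    by apply/funext => x; rewrite /s big_ord_recr.
  split; first by apply: integrable_torusD => //; exact: integrable_torusZ.
  rewrite RintegralD//=; last 2 first.
  - exact: measurable_torus.
  - exact: integrable_torusZ.
  rewrite IH add0r RintegralZl//; last exact: measurable_torus.
  (* A bare power of the cosine is the case of frequency 0 and phase 0. *)
  rewrite -[X in _ * X](_ : \int[mu]_(x in torus)
      (f x * (cos (x - x0) ^+ n * cos (0%:~R * x + 0))) = _).
    by rewrite integral_mul_cosX_eq0// mulr0.
  by apply: eq_Rintegral => x _; rewrite mul0r addr0 cos0 mulr1.
exact: (h _).2.
Qed.

End trigonometry.

(** * Uniqueness of Fourier coefficients *)

Section fourier_uniqueness.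
Context {R : realType}.
Local Notation mu := (@lebesgue_measure R).
Implicit Types (f g : R -> R) (k : int) (x y r : R).

Lemma dominated_torus (f_ : nat -> R -> R) f g :
  (forall n, measurable_fun torus (f_ n)) -> measurable_fun torus f ->
  {ae mu, forall x, torus x -> f_ ^~ x @ \oo --> f x} ->
  mu.-integrable torus (EFin \o g) ->
  (forall n x, torus x -> `|f_ n x| <= g x) ->
  mu.-integrable torus (EFin \o f) /\
  (fun n => \int[mu]_(x in torus) f_ n x) @ \oo --> \int[mu]_(x in torus) f x.
Proof.
move=> mf_ mf cf gi fg.
have [] := @dominated_convergence _ _ _ mu _ measurable_torus
  (fun n => EFin \o f_ n) (EFin \o f) (EFin \o g).
- by move=> n; apply/measurable_EFinP; exact: mf_.
- by apply/measurable_EFinP; exact: mf.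
- by apply: ae_torusS cf => x cx xT; apply: cvg_EFin; [exact: nearW|exact: cx].
- by [].
- by apply: aeW => x n xT; rewrite /= lee_fin fg.
move=> fi _ cfi; split=> //.
by apply: fine_cvg; rewrite fineK//; exact: (integrable_fin_num measurable_torus fi).
Qed.

Lemma bernoulli_ge (z : R) (m : nat) : 0 <= z <= 1 -> 1 - m%:R * z <= (1 - z) ^+ m.
Proof.
move=> /andP[z0 z1]; elim: m => [|m ih]; first by rewrite mul0r subr0 expr0.
rewrite exprSr (le_trans _ (ler_wpM2r _ ih)) ?subr_ge0//.
have : 0 <= m%:R * z ^+ 2 by rewrite mulr_ge0 ?sqr_ge0.
rewrite -natr1; nra.
Qed.

(** The upper companion of Bernoulli's inequality. The induction rests on [(1 - z) (1 + (m + 1) z) =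
    1 + m z - (m + 1) z^2], which is at most [1 + m z]. *)
Lemma bernoulli_le (z : R) (m : nat) : 0 <= z <= 1 -> (1 - z) ^+ m * (1 + m%:R * z) <= 1.
Proof.
move=> /andP[z0 z1]; elim: m => [|m ih]; first by rewrite expr0 mul0r addr0 mulr1.
apply: le_trans ih; rewrite exprSr -mulrA ler_wpM2l ?exprn_ge0 ?subr_ge0//.
have : 0 <= m%:R * z ^+ 2 by rewrite mulr_ge0 ?sqr_ge0.
rewrite -natr1; nra.
Qed.

(* Bernoulli's inequality makes [peak n y] tend to 1 for y < 1/2 and to 0 for
   y > 1/2: polynomials approximating, boundedly, the indicator of [0, 1/2]. *)
Definition peak (n : nat) (y : R) : R := (1 - y ^+ n) ^+ (2 ^ n).

Lemma peak01 n y : 0 <= y <= 1 -> 0 <= peak n y <= 1.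
Proof.
move=> /andP[y0 y1]; have yn0 : 0 <= y ^+ n by exact: exprn_ge0.
have yn1 : y ^+ n <= 1 by exact: exprn_ile1.
by rewrite exprn_ge0 ?subr_ge0// exprn_ile1 ?subr_ge0// lerBlDr lerDl.
Qed.

(** Squeezed between [1 - (2 y)^n] and 1: [bernoulli_ge] is applied with [z = y^n] and exponent
    [2^n]. *)
Lemma peak_cvg1 y : 0 <= y < 2^-1 -> peak ^~ y @ \oo --> (1 : R).
Proof.
move=> /andP[y0 y1]; have y2 : `|2 * y| < 1 by rewrite ger0_norm; lra.
have y01 : 0 <= y <= 1 by lra.
apply: (@squeeze_cvgr _ _ _ _ (fun n => 1 - (2 * y) ^+ n) (cst 1)).
- apply: nearW => n; have /andP[_ ->] := peak01 n y01; rewrite andbT.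
  rewrite exprMn -natrX; apply: bernoulli_ge.
  by rewrite exprn_ge0//= exprn_ile1//; lra.
- rewrite -[X in _ --> X]subr0; apply: cvgB; first exact: cvg_cst.
  exact: cvg_expr.
- exact: cvg_cst.
Qed.

(** Squeezed between 0 and [(2 y)^-n]: [bernoulli_le] gives [peak n y * (1 + (2 y)^n) <= 1]. *)
Lemma peak_cvg0 y : 2^-1 < y <= 1 -> peak ^~ y @ \oo --> (0 : R).
Proof.
move=> /andP[y0 y1]; have y2 : `|(2 * y)^-1| < 1.
  by rewrite ger0_norm ?invr_ge0; [rewrite invf_lt1; lra|lra].
have y01 : 0 <= y <= 1 by lra.
apply: (@squeeze_cvgr _ _ _ _ (cst 0) (fun n => (2 * y)^-1 ^+ n)).
- apply: nearW => n; have /andP[-> _] := peak01 n y01; rewrite andTb.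
  have yn : 0 < (2 * y) ^+ n by rewrite exprn_gt0//; lra.
  rewrite exprVn -[leRHS]mul1r ler_pdivlMr//.
  have := @bernoulli_le (y ^+ n) (2 ^ n); rewrite natrX -exprMn.
  have -> : 0 <= y ^+ n <= 1 by rewrite exprn_ge0 ?exprn_ile1//; lra.
  move=> /(_ isT); apply: le_trans; rewrite ler_wpM2l ?lerDr//.
  by have /andP[] := peak01 n y01.
- exact: cvg_cst.
- exact: cvg_expr.
Qed.

(** Cosine decreases on [[0, pi]]. The last two bounds on [r] keep the distance to [x0] below
    [2 * pi - r]; a distance beyond [pi] is reflected to [2 * pi] minus itself, which still exceeds
    [r]. *)
Lemma cos_arc x0 r x : 0 < r <= pi -> r < x0 -> r < 2 * pi - x0 ->
  0 <= x <= 2 * pi -> (`|x - x0| < r -> cos r < cos (x - x0)) /\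
                      (r < `|x - x0| -> cos (x - x0) < cos r).
Proof.
move=> /andP[r0 rpi] rx0 rx0' /andP[x_ge0 x_le].
rewrite -(cos_norm (x - x0)).
have hp := @pi_gt0 R.
have y0 : 0 <= `|x - x0| by [].
have y2 : `|x - x0| < 2 * pi - r by rewrite ltr_norml; apply/andP; split; lra.
move: (`|x - x0|) y0 y2 => y y0 y2; split=> yr.
  by rewrite ltr_cos// in_itv/=; lra.
have [ypi|ypi] := leP y pi; first by rewrite ltr_cos// in_itv/=; lra.
have -> : cos y = cos (2 * pi - y).
  by rewrite -[LHS]cosN -cosD2pi -[pi *+ 2]mulr_natl addrC.
by rewrite ltr_cos ?in_itv/=; lra.
Qed.

Lemma ae_torus_neq (a b : R) : {ae mu, forall x, x <> a /\ x <> b}.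
Proof.
exists [set a; b]; split.
- by apply: measurableU; exact: measurable_set1.
- by apply: countable_lebesgue_measure0; apply: finite_set_countable.
- move=> x /= /not_andP[] /contrapT ->; by [left|right].
Qed.

Lemma integral_arc_eq0 f x0 r : mu.-integrable torus (EFin \o f) ->
  (forall k, \int[mu]_(x in torus) (f x * cos (k%:~R * x)) = 0) ->
  (forall k, \int[mu]_(x in torus) (f x * sin (k%:~R * x)) = 0) ->
  0 < r <= pi / 2 -> r < x0 -> r < 2 * pi - x0 ->
  \int[mu]_(x in ball x0 r) f x = 0.
Proof.
move=> fi fcos fsin rp rx0 rx0'.
have hp := @pi_gt0 R.
have rpi : 0 < r <= pi by lra.
(* The bound [r <= pi / 2] serves here: with [cos r >= 0] the quotient [h] below stays at most 1. *)
have cr : 0 <= cos r by rewrite cos_ge0_pihalf//; lra.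
have /measurable_EFinP mf := measurable_int _ fi.
have mb : measurable (ball x0 r : set (measurableTypeR R)) by exact: measurable_ball.
have bT : ball x0 r `<=` torus.
  move=> x; rewrite /ball/= ltr_norml => h; rewrite /torus /= in_itv/=; lra.
(* h > 1/2 exactly on the arc. *)
pose h (x : R) := (1 + cos (x - x0)) / (2 * (1 + cos r)).
have h01 x : 0 <= h x <= 1.
  have := cos_geN1 (x - x0); have := cos_le1 (x - x0) => c1 c2.
  rewrite /h divr_ge0 ?ler_pdivrMr/=; lra.
pose f_ n x := f x * peak n (h x).
have f_0 n : \int[mu]_(x in torus) f_ n x = 0.
  pose p : {poly R} := (1 - ((1 + 'X) * (2 * (1 + cos r))^-1%:P) ^+ n) ^+ (2 ^ n).
  rewrite -(integral_mul_horner_cos_eq0 x0 p fi fcos fsin).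
  by apply: eq_Rintegral => x _; rewrite /f_ /peak /p !hornerE.
have mf_ n : measurable_fun torus (f_ n).
  apply: measurable_funM => //; apply: measurable_funX; apply: measurable_funB => //.
  apply: measurable_funX; apply: measurable_funM => //; apply: measurable_funD => //.
  by under eq_fun do rewrite -[X in X - x0]mul1r; exact: measurable_cos_affine.
(* The limit of [f_]: the factor [peak n (h x)] tends to 0 on the arc and to 1 off it. The two
   endpoints, where [h = 1/2], form a null set. *)
pose g := f \_ (~` ball x0 r).
have gi : mu.-integrable torus (EFin \o g).
  rewrite /g -restrict_EFin; apply/integrable_restrict => //.
  - exact: measurableC.
  - exact: measurable_torus.
  - apply: integrableS fi => //.
    + exact: measurable_torus.
    + apply: measurableI; [exact: measurable_torus|exact: measurableC].
have [||||_] := @dominated_torus f_ g (fun x => `|f x|) mf_.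
- by apply/measurable_EFinP; exact: measurable_int gi.
- apply: ae_torusS (ae_torus_neq (x0 - r) (x0 + r)) => x [n1 n2] xT.
  have xT' : 0 <= x <= 2 * pi by move: xT; rewrite /torus /= in_itv.
  have [lo hi] := cos_arc rpi rx0 rx0' xT'.
  rewrite /g patchE; case: ifPn => xb.
    have xr : r < `|x - x0|.
      move: xb; rewrite inE /ball/= => /negP; rewrite -leNgt distrC le_eqVlt.
      case/predU1P => // e; exfalso.
      by have [] := ler0P (x - x0); move: e; case: ger0P; lra.
    rewrite -[X in _ --> X]mulr1; apply: cvgM; first exact: cvg_cst.
    apply: peak_cvg1; have /andP[-> _] := h01 x.
    by rewrite /h ltr_pdivrMr; have := hi xr; lra.
  have xr : `|x - x0| < r.
    by move: xb; rewrite notin_setE /ball/= => /contrapT; rewrite distrC.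
  rewrite -[X in _ --> X](mulr0 (f x)); apply: cvgM; first exact: cvg_cst.
  apply: peak_cvg0; have /andP[_ ->] := h01 x.
  by rewrite andbT /h ltr_pdivlMr; have := lo xr; lra.
- exact: integrable_abse fi.
- move=> n x _; rewrite normrM ler_piMr//=.
  by have /andP[p0 p1] := peak01 n (h01 x); rewrite ger0_norm.
under eq_fun do rewrite f_0.
move=> /(cvg_lim (@Rhausdorff R)); rewrite lim_cst// => g0.
have -> : ball x0 r = torus `&` ball x0 r by apply/esym/setIidPr.
rewrite Rintegral_mkcondr.
(* Frequency 0 of the cosine assumption. Subtracting the part of [f] off the arc, whose integral was
   just shown to vanish, leaves the integral over the arc. *)
have f0 : \int[mu]_(x in torus) f x = 0.
  rewrite -(fcos 0); apply: eq_Rintegral => x _.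
  by rewrite mul0r cos0 mulr1.
have -> : 0 = \int[mu]_(x in torus) f x - \int[mu]_(x in torus) g x.
  by rewrite f0 -g0 subrr.
rewrite -RintegralB//; last exact: measurable_torus.
apply: eq_Rintegral => x _; rewrite /g !patchE in_setC.
by case: ifPn => _ /=; rewrite ?subr0 ?subrr.
Qed.

(** As [f] has mean 0 on the ball, [- f x] is the mean of [f y - f x], and the mean of the modulus
    is at least the modulus of the mean. *)
Lemma davg_ge_integral0 f x r : 0 < r -> mu.-integrable (ball x r) (EFin \o f) ->
  \int[mu]_(y in ball x r) f y = 0 -> (`|f x|%:E <= davg f x r)%E.
Proof.
move=> r0 fi f0.
have mb : measurable (ball x r : set (measurableTypeR R)) by exact: measurable_ball.
have ci : mu.-integrable (ball x r) (EFin \o cst (f x)).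
  apply: measurable_bounded_integrable => //.
  - by rewrite [X in (X < _)%E](lebesgue_measure_ball _ (ltW r0)) ltry.
  - by exists `|f x|; split; [exact: num_real|move=> M /ltW fM y _].
have di : mu.-integrable (ball x r) (EFin \o (fun y => f y - f x)).
  exact: (integrableB mb fi ci).
rewrite /davg /iavg (lebesgue_measure_ball _ (ltW r0)).
have mf := measurable_int _ di.
have := le_abse_integral mu mb mf; rewrite -EFin_normr_Rintegral// RintegralB//.
rewrite f0 Rintegral_cst// [X in fine X](lebesgue_measure_ball _ (ltW r0)) /=.
have r2 : 0 < r *+ 2 by rewrite mulrn_wgt0.
rewrite sub0r normrN normrM (gtr0_norm r2) => h.
by rewrite inver (gt_eqF r2) lee_pdivlMl// -EFinM mulrC.
Qed.

(** At a Lebesgue point the averaged deviation tends to 0 with the radius, while vanishing integrals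
    over small arcs keep it at least [|f x|]. *)
Lemma fourier_unique f : mu.-integrable torus (EFin \o f) ->
  (forall k, \int[mu]_(x in torus) (f x * cos (k%:~R * x)) = 0) ->
  (forall k, \int[mu]_(x in torus) (f x * sin (k%:~R * x)) = 0) ->
  {ae mu, forall x, torus x -> f x = 0}.
Proof.
move=> fi fcos fsin.
have hp := @pi_gt0 R.
(* Differentiation is applied on the whole line, to the extension by zero; for [x] in the open
   interval the small balls stay inside it, where [F] and [f] agree. *)
pose F := f \_ torus.
have Fi : mu.-integrable setT (EFin \o F).
  rewrite /F -restrict_EFin.
  exact: (@integrable_mkcond _ _ _ mu _ (EFin \o f) measurable_torus).1 fi.
have := lebesgue_differentiation (open_integrable_locally openT Fi).
move=> /filterI /(_ (ae_torus_neq 0 (2 * pi))).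
apply: ae_torusS => x [Fx [x0 x2pi]] xT.
have /andP[x_gt0 x_lt] : 0 < x < 2 * pi.
  move: xT; rewrite /torus /= in_itv /= => /andP[xl xr].
  by rewrite !lt_neqAle xl xr !andbT eq_sym; apply/andP; split; exact/eqP.
have fF y : torus y -> F y = f y by move=> yT; rewrite /F patchE mem_set.
rewrite -fF//; apply/eqP; rewrite -normr_le0 -lee_fin.
apply: cvge_ge Fx; near=> r.
have r0 : 0 < r by near: r; exact: nbhs_right_gt.
have rp : r < pi / 2 by near: r; apply: nbhs_right_lt; lra.
have rx : r < x by near: r; exact: nbhs_right_lt.
have rx' : r < 2 * pi - x by near: r; apply: nbhs_right_lt; lra.
apply: davg_ge_integral0 => //.
  apply: (integrableS measurableT _ _ Fi) => //; exact: measurable_ball.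
rewrite -[RHS](@integral_arc_eq0 f x r)//; last by rewrite r0 ltW.
apply: eq_Rintegral => y /[!inE]; rewrite /ball /= ltr_norml => yr.
by apply: fF; rewrite /torus /= in_itv /=; lra.
Unshelve. all: by end_near. Qed.

End fourier_uniqueness.

(** * Unordered sums over the integers as series along the order 0, -1, 1, -2, 2, .. *)

Definition int_enum (n : nat) : int := if odd n then Negz n./2 else Posz n./2.

Lemma int_enum_bij : bijective int_enum.
Proof.
exists (fun k : int => match k with Posz m => m.*2 | Negz m => m.*2.+1 end).
  move=> n; rewrite /int_enum; have := odd_double_half n.
  by case: (odd n) => //=; rewrite ?add1n ?add0n.
by case=> m; rewrite /int_enum /= odd_double /= ?doubleK// uphalf_double.
Qed.

Section sums_over_int.
Context {R : realType}.
Implicit Types (f g : int -> R) (w : int -> R[i]).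

Lemma esum_int_enum (a : int -> \bar R) : (forall k, 0 <= a k)%E ->
  (\esum_(k in [set: int]) a k = \sum_(0 <= i <oo) a (int_enum i))%E.
Proof.
move=> a0; rewrite nneseries_esumT//; apply: reindex_esum => //.
by rewrite setTT_bijective; exact: int_enum_bij.
Qed.

Definition abs_summable f := (\esum_(k in [set: int]) `|f k|%:E < +oo)%E.

Lemma abs_summable_le f g : (forall k, `|f k| <= g k) ->
  (\esum_(k in [set: int]) (g k)%:E < +oo)%E -> abs_summable f.
Proof. by move=> fg; apply: le_lt_trans; apply: le_esum => k _; rewrite lee_fin. Qed.

Lemma sum_le_esum f : (forall k, 0 <= f k) ->
  (\esum_(k in [set: int]) (f k)%:E < +oo)%E ->
  forall n, \sum_(0 <= i < n) f (int_enum i)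
    <= fine (\esum_(k in [set: int]) (f k)%:E).
Proof.
move=> f0 fs n; have s0 : (0 <= \esum_(k in [set: int]) (f k)%:E)%E.
  by apply: esum_ge0 => k _; rewrite lee_fin.
rewrite -lee_fin fineK ?ge0_fin_numE// esum_int_enum => [|k]; last by rewrite lee_fin.
by rewrite -sumEFin; apply: nneseries_lim_ge => i _ _; rewrite lee_fin.
Qed.

Lemma cvg_sum_esum f : (forall k, 0 <= f k) ->
  (\esum_(k in [set: int]) (f k)%:E < +oo)%E ->
  (fun n => \sum_(0 <= i < n) f (int_enum i)) @ \oo -->
    fine (\esum_(k in [set: int]) (f k)%:E).
Proof.
move=> f0 fs; have s0 : (0 <= \esum_(k in [set: int]) (f k)%:E)%E.
  by apply: esum_ge0 => k _; rewrite lee_fin.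
apply: (@fine_cvg _ _ _ _ (fun n => (\sum_(0 <= i < n) f (int_enum i))%:E)).
rewrite fineK ?ge0_fin_numE// esum_int_enum => [|k]; last by rewrite lee_fin.
have /(_ (fun i => (f (int_enum i))%:E) xpredT 0%N) := @is_cvg_nneseries R.
under eq_fun do rewrite sumEFin.
by apply=> i _ _; rewrite lee_fin.
Qed.

(** Links the order-free sum to ordered partial sums: absolute summability makes the positive and
    negative parts converge separately. *)
Lemma cvg_rsum f : abs_summable f ->
  (fun n => \sum_(0 <= i < n) f (int_enum i)) @ \oo --> rsum [set: int] f.
Proof.
move=> fs.
have lt_pn (g : int -> R) : (forall k, 0 <= g k <= `|f k|) ->
    (\esum_(k in [set: int]) (g k)%:E < +oo)%E.
  move=> h; apply: le_lt_trans fs; apply: le_esum => k _.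
  by rewrite lee_fin; have /andP[] := h k.
have pf k : 0 <= f^\+ k <= `|f k|.
  rewrite /funrpos le_max lexx orbT/= ge_max ler_norm normr_ge0//.
have nf k : 0 <= f^\- k <= `|f k|.
  by rewrite /funrneg le_max lexx orbT/= ge_max -normrN ler_norm normr_ge0.
have -> : (fun n => \sum_(0 <= i < n) f (int_enum i)) =
    (fun n => \sum_(0 <= i < n) f^\+ (int_enum i) - \sum_(0 <= i < n) f^\- (int_enum i)).
  apply/funext => n; rewrite -sumrB; apply: eq_bigr => i _.
  by rewrite -[in LHS](funrposBneg f).
apply: cvgB; apply: cvg_sum_esum => //.
- exact: lt_pn pf.
- exact: lt_pn nf.
Qed.

Definition csummable w := (\esum_(k in [set: int]) (cmod (w k))%:E < +oo)%E.

Lemma cmod_ge0 (z : R[i]) : 0 <= cmod z.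
Proof. by case: z => a b; exact: sqrtr_ge0. Qed.

Lemma Re_le_cmod (z : R[i]) : `|complex.Re z| <= cmod z.
Proof. by case: z => a b /=; rewrite -sqrtr_sqr ler_wsqrtr// lerDl sqr_ge0. Qed.

Lemma Im_le_cmod (z : R[i]) : `|complex.Im z| <= cmod z.
Proof. by case: z => a b /=; rewrite -sqrtr_sqr ler_wsqrtr// lerDr sqr_ge0. Qed.

Lemma cmod_expi (y : R) : cmod (expi y) = 1.
Proof. by rewrite /= cos2Dsin2 sqrtr1. Qed.

Lemma cmodM (z z' : R[i]) : cmod (z * z') = cmod z * cmod z'.
Proof. exact: ComplexField.Normc.normcM. Qed.

Lemma csummable_expi w (y : int -> R) :
  csummable w -> csummable (fun k => expi (y k) * w k).
Proof.
by apply: le_lt_trans; apply: le_esum => k _; rewrite cmodM cmod_expi mul1r.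
Qed.

Lemma csummableD w w' : csummable w -> csummable w' ->
  csummable (fun k => w k + w' k).
Proof.
move=> ws ws'; apply: le_lt_trans (lte_add_pinfty ws ws').
rewrite -esumD; [|by move=> k _; rewrite lee_fin cmod_ge0..].
by apply: le_esum => k _; rewrite lee_fin; exact: le_normcD.
Qed.

Lemma csummableZ (z : R[i]) w : csummable w -> csummable (fun k => z * w k).
Proof.
move=> ws; have ws0 : (0 <= \esum_(k in [set: int]) (cmod (w k))%:E)%E.
  by apply: esum_ge0 => k _; rewrite lee_fin cmod_ge0.
rewrite /csummable; under eq_esum do rewrite cmodM EFinM.
rewrite esum_int_enum => [|k]; last by rewrite mule_ge0// lee_fin cmod_ge0.
rewrite nneseriesZl => [|i _]; last by rewrite lee_fin cmod_ge0.
rewrite -(@esum_int_enum (fun k => (cmod (w k))%:E)); last first.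
  by move=> k; rewrite lee_fin cmod_ge0.
by rewrite lte_mul_pinfty// lee_fin cmod_ge0.
Qed.

End sums_over_int.

(** * Fourier series, their partial sums and measurability *)

Section fourier_series.
Context {R : realType}.
Local Notation mu := (@lebesgue_measure R).
Implicit Types (w : int -> R[i]) (u v : R -> R[i]).

Definition wave (k : int) (z : R[i]) : R -> R[i] := fun x => expi (k%:~R * x) * z.

Definition partial_series w n : R -> R[i] := fun x =>
  \sum_(0 <= i < n) wave (int_enum i) (w (int_enum i)) x.

Lemma Re_fourier_series_cvg w x : csummable w ->
  (fun n => complex.Re (partial_series w n x)) @ \oo -->
    complex.Re (fourier_series w x).
Proof.
move=> ws; under eq_fun do rewrite Re_sum.
apply: (@cvg_rsum R (fun k => complex.Re (wave k (w k) x))).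
apply: abs_summable_le (csummable_expi (fun k => k%:~R * x) ws) => k.
exact: Re_le_cmod.
Qed.

Lemma Im_fourier_series_cvg w x : csummable w ->
  (fun n => complex.Im (partial_series w n x)) @ \oo -->
    complex.Im (fourier_series w x).
Proof.
move=> ws; under eq_fun do rewrite Im_sum.
apply: (@cvg_rsum R (fun k => complex.Im (wave k (w k) x))).
apply: abs_summable_le (csummable_expi (fun k => k%:~R * x) ws) => k.
exact: Im_le_cmod.
Qed.

(** A bound for all partial sums, uniform in [n] and [x]: the dominating constant in the passages to
    the limit. *)
Definition l1_norm w : R := fine (\esum_(k in [set: int]) (cmod (w k))%:E)%E.

Lemma Re_partial_series_le w n x : csummable w ->
  `|complex.Re (partial_series w n x)| <= l1_norm w.
Proof.
move=> ws; rewrite Re_sum (le_trans (ler_norm_sum _ _ _))//.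
apply: le_trans (sum_le_esum (fun k => cmod_ge0 (w k)) ws n).
apply: ler_sum => i _; apply: le_trans (Re_le_cmod _) _.
by rewrite cmodM cmod_expi mul1r.
Qed.

Lemma Im_partial_series_le w n x : csummable w ->
  `|complex.Im (partial_series w n x)| <= l1_norm w.
Proof.
move=> ws; rewrite Im_sum (le_trans (ler_norm_sum _ _ _))//.
apply: le_trans (sum_le_esum (fun k => cmod_ge0 (w k)) ws n).
apply: ler_sum => i _; apply: le_trans (Im_le_cmod _) _.
by rewrite cmodM cmod_expi mul1r.
Qed.

Lemma measurable_sin_affine (D : set R) (a b : R) :
  measurable_fun D (fun x : R => sin (a * x + b)).
Proof.
under eq_fun do rewrite -cosBpihalf -addrA; exact: measurable_cos_affine.
Qed.

Lemma measurable_wave k z : torus_measurable (wave k z).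
Proof.
have mc : measurable_fun torus (fun x : R => cos (k%:~R * x)).
  by under eq_fun do rewrite -[_ * _]addr0; exact: measurable_cos_affine.
have ms : measurable_fun torus (fun x : R => sin (k%:~R * x)).
  by under eq_fun do rewrite -[_ * _]addr0; exact: measurable_sin_affine.
split.
  under eq_fun do rewrite /wave ReM /=.
  by apply: measurable_funB; exact: measurable_funM.
under eq_fun do rewrite /wave ImM /=.
by apply: measurable_funD; exact: measurable_funM.
Qed.

Lemma L2c_wave k z : L2c (wave k z).
Proof.
have [mr mi] := measurable_wave k z.
split.
  apply: (@bounded_square_integrable _ _ (cmod z)) => // x _.
  by rewrite (le_trans (Re_le_cmod _))// cmodM cmod_expi mul1r.
apply: (@bounded_square_integrable _ _ (cmod z)) => // x _.
by rewrite (le_trans (Im_le_cmod _))// cmodM cmod_expi mul1r.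
Qed.

(* No summability: the coefficients in [discF] and [discP] may fail to be summable,
   and [rsum] then takes a junk value, but still measurably in [x]. *)
Lemma measurable_rsum (h : int -> R -> R) :
  (forall k, measurable_fun torus (h k)) ->
  measurable_fun torus (fun x => rsum [set: int] (fun k => h k x)).
Proof.
move=> mh.
have mp (g : int -> R -> R) : (forall k x, 0 <= g k x) ->
    (forall k, measurable_fun torus (g k)) ->
    measurable_fun torus (fun x => fine (\esum_(k in [set: int]) (g k x)%:E)).
  move=> g0 mg; apply: (measurableT_comp (fine_measurable measurableT)).
  under eq_fun => x do
    (rewrite esum_int_enum; last by move=> k; rewrite lee_fin).
  apply: ge0_emeasurable_sum => [i x _ _|i _]; first by rewrite lee_fin.
  by apply/measurable_EFinP; exact: mg.
apply: measurable_funB; apply: mp.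
- by move=> k x; rewrite /funrpos le_max lexx orbT.
- by move=> k; apply: measurable_maxr => //; exact: mh.
- by move=> k x; rewrite /funrneg le_max lexx orbT.
- by move=> k; apply: measurable_maxr => //; apply: measurable_funN; exact: mh.
Qed.

Lemma measurable_fourier_series w : torus_measurable (fourier_series w).
Proof.
by split; apply: measurable_rsum => k; have [] := measurable_wave k (w k).
Qed.

End fourier_series.

(** * Parseval's identity and the Fourier expansion *)

Section parseval.
Context {R : realType}.
Local Notation mu := (@lebesgue_measure R).
Implicit Types (w : int -> R[i]) (u v : R -> R[i]) (k l : int) (z : R[i]).

Lemma cvgr_norm_bound (f : nat -> R) (l M : R) :
  f @ \oo --> l -> (forall n, `|f n| <= M) -> `|l| <= M.
Proof.
move=> fl fM; have nfl : `|f n| @[n --> \oo] --> `|l| by exact: cvg_norm fl.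
rewrite -(cvg_lim (@Rhausdorff R) nfl); apply: limr_le; first exact: cvgP nfl.
by apply: nearW => n; exact: fM.
Qed.

Lemma L2c_partial_series w n : L2c (partial_series w n).
Proof. by apply: L2c_sum => i; exact: L2c_wave. Qed.

Lemma L2c_fourier_series w : csummable w -> L2c (fourier_series w).
Proof.
move=> ws; have [mr mi] := measurable_fourier_series w.
split; apply: (@bounded_square_integrable _ _ (l1_norm w)) => // x _.
  apply: (cvgr_norm_bound (@Re_fourier_series_cvg R _ x ws)) => n.
  exact: Re_partial_series_le.
apply: (cvgr_norm_bound (@Im_fourier_series_cvg R _ x ws)) => n.
exact: Im_partial_series_le.
Qed.

(** Dominated convergence: [l1_norm w] bounds the series, and [v], being square integrable, is
    integrable on the torus. *)
Lemma ip_partial_series_cvg w v : csummable w -> L2c v ->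
  (fun n => ip (partial_series w n) v) @ \oo --> ip (fourier_series w) v.
Proof.
move=> ws v2; have [[mr _] [mi _]] := v2.
have [mFr mFi] := measurable_fourier_series w.
have abs_int (f : R -> R) : square_integrable f ->
    mu.-integrable torus (EFin \o (fun x => l1_norm w * `|f x|)).
  move=> f2; apply: integrable_torusZ.
  exact: integrable_abse (square_integrable_torus f2).
have [|||||_] := @dominated_torus R
  (fun n x => complex.Re (partial_series w n x) * complex.Re (v x)
            + complex.Im (partial_series w n x) * complex.Im (v x))
  (fun x => complex.Re (fourier_series w x) * complex.Re (v x)
          + complex.Im (fourier_series w x) * complex.Im (v x))
  (fun x => l1_norm w * `|complex.Re (v x)| + l1_norm w * `|complex.Im (v x)|) => //.
- move=> n; have [mSr mSi] := L2c_measurable (L2c_partial_series w n).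
  by apply: measurable_funD; exact: measurable_funM.
- by apply: measurable_funD; exact: measurable_funM.
- apply: aeW => x _; apply: cvgD; apply: cvgMr_tmp.
  + exact: Re_fourier_series_cvg.
  + exact: Im_fourier_series_cvg.
- by have [? ?] := v2; apply: integrable_torusD; exact: abs_int.
- move=> n x _; rewrite (le_trans (ler_normD _ _))// !normrM lerD//.
    by rewrite ler_wpM2r// Re_partial_series_le.
  by rewrite ler_wpM2r// Im_partial_series_le.
Qed.

Lemma ip_wave k l z z' : ip (wave k z) (wave l z') =
  (k == l)%:R * (2 * pi) * (complex.Re z * complex.Re z' + complex.Im z * complex.Im z').
Proof.
have int1 (a b r : R) : mu.-integrable torus (EFin \o (fun x => r * cos (a * x + b))).
  apply: (@bounded_integrable_torus _ _ `|r|).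
    by apply: measurable_funM => //; exact: measurable_cos_affine.
  by move=> x _; rewrite normrM ler_piMr// cos_max.
(* [A] and [- B] are the real and imaginary parts of [z] times the conjugate of [z']. The sine is
   written as a cosine of phase [- (pi / 2)], so that one integral formula covers both terms and
   removes the one with [B]. *)
pose A := complex.Re z * complex.Re z' + complex.Im z * complex.Im z'.
pose B := complex.Re z * complex.Im z' - complex.Im z * complex.Re z'.
transitivity (\int[mu]_(x in torus) (A * cos ((k - l)%:~R * x + 0) +
                                     B * cos ((k - l)%:~R * x + - (pi / 2)))).
  apply: eq_Rintegral => x _; rewrite cosBpihalf addr0 /wave !ReM !ImM /=.
  by rewrite intrB [(_ - _) * x]mulrBl cosB sinB /A /B; ring.
rewrite RintegralD //; last exact: measurable_torus.
have icos (b : R) : mu.-integrable torus (EFin \o (fun x => cos ((k - l)%:~R * x + b))).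
  by have := int1 (k - l)%:~R b 1; under eq_fun do rewrite mul1r.
rewrite !RintegralZl//; [|exact: measurable_torus..].
rewrite !integral_cos_affine_kron cos0 cosN cos_pihalf mulr0 mulr0 addr0 mulr1.
by rewrite subr_eq0 mulrC.
Qed.

(** Once the partial sums have passed the position of [k] in the enumeration, orthogonality leaves a
    single term, so the convergent sequence is eventually constant. *)
Lemma ip_fourier_series_wave w k z : csummable w ->
  ip (fourier_series w) (wave k z) =
  2 * pi * (complex.Re (w k) * complex.Re z + complex.Im (w k) * complex.Im z).
Proof.
move=> ws; have := ip_partial_series_cvg ws (L2c_wave k z).
have [e' e'K eK'] := int_enum_bij.
move=> /(cvg_lim (@Rhausdorff R)) <-.
apply/cvg_lim => //; apply: cvg_near_cst; exists (e' k).+1 => // n /= kn.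
rewrite /partial_series ip_suml//; first last.
- exact: L2c_wave.
- by move=> i; exact: L2c_wave.
rewrite (bigD1_seq (e' k)) ?iota_uniq ?mem_index_iota//= eK' ip_wave eqxx mul1r.
rewrite big1 ?addr0// => i ik; rewrite ip_wave.
rewrite (_ : (int_enum i == k) = false) ?mul0r//.
by apply/eqP => e; move: ik; rewrite -e e'K eqxx.
Qed.

(** Both masses are limits of the same sums of [2 * pi * |w k|^2]. *)
Lemma mass_fourier_series w w' : csummable w -> csummable w' ->
  (forall k, cmod (w k) = cmod (w' k)) ->
  mass (fourier_series w) = mass (fourier_series w').
Proof.
move=> ws ws' ww'; rewrite !mass_ip; try exact: L2c_fourier_series.
congr EFin.
have h (y : int -> R[i]) : csummable y ->
    (fun n => \sum_(0 <= i < n) (2 * pi * cmod (y (int_enum i)) ^+ 2)) @ \oo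
    --> ip (fourier_series y) (fourier_series y).
  move=> ys; have F2 := L2c_fourier_series ys.
  have := ip_partial_series_cvg ys F2.
  rewrite (_ : (fun n => _) =
    (fun n => \sum_(0 <= i < n) (2 * pi * cmod (y (int_enum i)) ^+ 2)))//.
  apply/funext => n; rewrite /partial_series ip_suml//; last first.
    by move=> i; exact: L2c_wave.
  apply: eq_bigr => i _; rewrite ipC ip_fourier_series_wave//.
  by rewrite sqr_cmod !expr2.
have := h _ ws; under eq_fun do under eq_bigr do rewrite ww'.
by move=> /(cvg_lim (@Rhausdorff R)) <-; apply/cvg_lim => //; exact: h.
Qed.

(** Both components become real inner products, the imaginary one by pairing with [i e^(ikx)]; real
    linearity of the coefficients then follows from that of [ip]. *)
Lemma fourierE u k : fourier u k =
  ((2 * pi)^-1 * ip u (wave k 1)) +i* ((2 * pi)^-1 * ip u (wave k 'i%C)).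
Proof.
rewrite /fourier /cintegral; apply/eqP; rewrite eq_complex !(ReM, ImM) /=.
rewrite !mul0r subr0 addr0; apply/andP; split; apply/eqP; congr (_ * _);
  apply: eq_Rintegral => x _; rewrite /wave !(ReM, ImM) /= sinN cosN; ring.
Qed.

Lemma ip_wave_fourier u k z : L2c u -> ip u (wave k z) =
  2 * pi * (complex.Re (fourier u k) * complex.Re z
          + complex.Im (fourier u k) * complex.Im z).
Proof.
move=> u2; rewrite fourierE /=.
transitivity (complex.Re z * ip u (wave k 1) + complex.Im z * ip u (wave k 'i%C)).
  rewrite 3!(ipC u) -!ipZl//; [|exact: L2c_wave..].
  rewrite -ipDl//; [|exact/L2cZ/L2c_wave..].
  congr ip; apply/funext => x; rewrite /wave.
  rewrite mulrCA [X in _ + X]mulrCA -mulrDr; congr (_ * _).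
  case: z => a b; apply/eqP.
  by rewrite eq_complex /= !(mulr0, mulr1, mul0r, subr0, add0r, addr0) !eqxx.
move: (ip _ _) (ip _ _) (@pi_gt0 R) => A B.
by move: pi => p p0; field; rewrite gt_eqF.
Qed.

(** The difference [v] of the two sides is orthogonal to every wave, and uniqueness is applied to
    its real and imaginary parts separately. *)
Lemma eqT_fourier_series u : L2c u -> csummable (fourier u) ->
  eqT u (fourier_series (fourier u)).
Proof.
move=> u2 us; have F2 := L2c_fourier_series us.
pose v x := u x + (- 1)%:C * fourier_series (fourier u) x.
have v2 : L2c v by exact/L2cD/L2cZ.
(* Two waves at once: frequencies [k] and [- k] with amplitudes of modulus 1/2 combine to
   [cos (k x)], [sin (k x)], or [i] times these, which test one component of [v] at a time. *)
have v0 k z k' z' : ip v (fun x => wave k z x + wave k' z' x) = 0.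
  have vw l y : ip v (wave l y) = 0.
    rewrite ipDl//; [|exact: L2cZ|exact: L2c_wave].
    rewrite ipZl//; last exact: L2c_wave.
    by rewrite ip_wave_fourier// ip_fourier_series_wave// mulN1r subrr.
  rewrite ipC ipDl//; [|exact: L2c_wave..].
  by rewrite !(ipC _ v) !vw addr0.
have vE x : v x = u x + (- 1)%:C * fourier_series (fourier u) x by [].
clearbody v; have [vr vi] := v2.
have vr0 : {ae mu, forall x, torus x -> complex.Re (v x) = 0}.
  apply: fourier_unique; first exact: square_integrable_torus.
    move=> k; rewrite -[RHS](v0 k (2^-1)%:C (- k) (2^-1)%:C).
    apply: eq_Rintegral => x _; rewrite /wave !(ReD, ImD, ReM, ImM) /=.
    by rewrite intrN mulNr cosN sinN; field.
  move=> k; rewrite -[RHS](v0 k (0 +i* - 2^-1) (- k) (0 +i* 2^-1)).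
  apply: eq_Rintegral => x _; rewrite /wave !(ReD, ImD, ReM, ImM) /=.
  by rewrite intrN mulNr cosN sinN; field.
have vi0 : {ae mu, forall x, torus x -> complex.Im (v x) = 0}.
  apply: fourier_unique; first exact: square_integrable_torus.
    move=> k; rewrite -[RHS](v0 k (0 +i* 2^-1) (- k) (0 +i* 2^-1)).
    apply: eq_Rintegral => x _; rewrite /wave !(ReD, ImD, ReM, ImM) /=.
    by rewrite intrN mulNr cosN sinN; field.
  move=> k; rewrite -[RHS](v0 k (2^-1)%:C (- k) (- 2^-1)%:C).
  apply: eq_Rintegral => x _; rewrite /wave !(ReD, ImD, ReM, ImM) /=.
  by rewrite intrN mulNr cosN sinN; field.
apply: filterS2 vr0 vi0 => x hr hi xT.
have /eqP : v x = 0.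
  by apply/eqP; rewrite eq_complex hr// hi//= eqxx.
have -> : v x = u x - fourier_series (fourier u) x.
  rewrite vE -[- fourier_series _ _]mulN1r; congr (_ + _ * _).
  by apply/eqP; rewrite eq_complex /= oppr0 !eqxx.
by rewrite subr_eq0 => /eqP.
Qed.

Lemma mass_fourier_multiplier u (y : int -> R) : L2c u -> csummable (fourier u) ->
  mass (fourier_series (fun k => expi (y k) * fourier u k)) = mass u.
Proof.
move=> u2 us; rewrite (@mass_fourier_series _ (fourier u))//.
- rewrite (mass_ae _ _ (eqT_fourier_series u2 us))//.
    exact: L2c_measurable.
  exact: measurable_fourier_series.
- exact: csummable_expi.
- by move=> k; rewrite cmodM cmod_expi mul1r.
Qed.

Lemma fourierD u v k : L2c u -> L2c v ->
  fourier (fun x => u x + v x) k = fourier u k + fourier v k.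
Proof.
move=> u2 v2; rewrite !fourierE !ipDl//; [|exact: L2c_wave..].
by apply/eqP; rewrite eq_complex /= !mulrDr !eqxx.
Qed.

Lemma fourierZ (r : R) u k : L2c u ->
  fourier (fun x => r%:C * u x) k = r%:C * fourier u k.
Proof.
move=> u2; rewrite !fourierE !ipZl//; [|exact: L2c_wave..].
by apply/eqP; rewrite eq_complex /= !mul0r subr0 addr0 ![_ * (r * _)]mulrCA !eqxx.
Qed.

(** Positive and negative parts are not additive, so additivity is read off the limits of the
    partial sums. *)
Lemma fourier_seriesD w w' x : csummable w -> csummable w' ->
  fourier_series (fun k => w k + w' k) x = fourier_series w x + fourier_series w' x.
Proof.
move=> ws ws'; have wws := csummableD ws ws'.
have e n : partial_series (fun k => w k + w' k) n x =
    partial_series w n x + partial_series w' n x.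
  by rewrite -big_split; apply: eq_bigr => i _; rewrite /wave mulrDr.
apply/eqP; rewrite eq_complex ReD ImD; apply/andP; split; apply/eqP.
  have := @Re_fourier_series_cvg R _ x wws; under eq_fun do rewrite e ReD.
  move=> /(cvg_lim (@Rhausdorff R)) <-; apply/cvg_lim => //.
  by apply: cvgD; exact: Re_fourier_series_cvg.
have := @Im_fourier_series_cvg R _ x wws; under eq_fun do rewrite e ImD.
move=> /(cvg_lim (@Rhausdorff R)) <-; apply/cvg_lim => //.
by apply: cvgD; exact: Im_fourier_series_cvg.
Qed.

Lemma fourier_seriesZ (r : R) w x : csummable w ->
  fourier_series (fun k => r%:C * w k) x = r%:C * fourier_series w x.
Proof.
move=> ws; have rws := csummableZ r%:C ws.
have e n : partial_series (fun k => r%:C * w k) n x =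
    r%:C * partial_series w n x.
  by rewrite mulr_sumr; apply: eq_bigr => i _; rewrite /wave mulrCA.
apply/eqP; rewrite eq_complex ReZ ImZ; apply/andP; split; apply/eqP.
  have := @Re_fourier_series_cvg R _ x rws.
  under eq_fun do rewrite e ReZ.
  move=> /(cvg_lim (@Rhausdorff R)) <-; apply/cvg_lim => //.
  by apply: cvgMl_tmp; exact: Re_fourier_series_cvg.
have := @Im_fourier_series_cvg R _ x rws.
under eq_fun do rewrite e ImZ.
move=> /(cvg_lim (@Rhausdorff R)) <-; apply/cvg_lim => //.
by apply: cvgMl_tmp; exact: Im_fourier_series_cvg.
Qed.

End parseval.

(** * Absolute summability of Fourier coefficients from Sobolev regularity *)

Section sobolev.
Context {R : realType}.

Lemma sum_inv_enum_le (n : nat) :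
  \sum_(0 <= i < n) (1 + (int_enum i)%:~R ^+ 2 : R)^-1 <= 8 * (1 - n.+1%:R^-1).
Proof.
elim: n => [|n ih]; first by rewrite big_geq// invr1 subrr mulr0.
rewrite big_nat_recr//=.
(* The integer at position [n] has absolute value at least [n / 2]. *)
have e2 : (n%:R : R) ^+ 2 <= 4 * (int_enum n)%:~R ^+ 2.
  rewrite -[in leLHS](odd_double_half n) /int_enum natrD -mul2n natrM.
  case: (odd n); last by rewrite add0r -pmulrn exprMn -natrX.
  have := ler0n R n./2; rewrite NegzE mulrNz sqrrN -pmulrn -[n./2.+1%:R]natr1 -[true%:R]/1.
  move: (n./2%:R) => h h0; nra.
have n0 := ler0n R n.
(* Telescoping: the new term is at most [8 / ((n + 1) (n + 2))], the increment of the right-hand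
   side. *)
apply: (@le_trans _ _ (8 * (1 - n.+1%:R^-1) + 8 * (n.+1%:R^-1 - n.+2%:R^-1))).
  apply: lerD => //.
  have -> : n.+1%:R^-1 - n.+2%:R^-1 = ((n%:R + 1) * (n%:R + 2))^-1 :> R.
    by rewrite -[n.+2%:R]natr1 -[n.+1%:R]natr1; field; lra.
  rewrite -[8]invrK -invfM lef_pV2 ?posrE; last 2 first.
  - by rewrite ltr_pwDl// sqr_ge0.
  - by rewrite mulr_gt0 ?invr_gt0// mulr_gt0//; lra.
  rewrite ler_pdivrMl//; nra.
by rewrite -mulrDr addrA subrK.
Qed.

(** Sobolev regularity enters the proof through this lemma: it puts the functions of the scheme
    within reach of Parseval and of the linearity of the free evolution. *)
Lemma HT_csummable (s : R) (u : R -> R[i]) : 1 < s -> HT s u -> csummable (fourier u).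
Proof.
move=> s1 [_ hs].
pose a (k : int) : R := 1 + k%:~R ^+ 2.
have a1 k : 1 <= a k by rewrite lerDl sqr_ge0.
have a0 k : 0 < a k by exact: lt_le_trans (a1 k).
have sa : (\esum_(k in [set: int]) ((a k)^-1)%:E < +oo)%E.
  rewrite esum_int_enum => [|k]; last by rewrite lee_fin invr_ge0 ltW.
  apply: (@le_lt_trans _ _ 8%:E); last exact: ltry.
  apply: lime_le; first by apply: is_cvg_nneseries => i _ _; rewrite lee_fin invr_ge0 ltW.
  apply: nearW => n; rewrite sumEFin lee_fin (le_trans (sum_inv_enum_le n))//.
  by rewrite ler_piMr// gerBl invr_ge0.
(* AM-GM: [c <= 1 / x + x c^2], with [x = 1 + k^2 <= (1 + k^2)^s]. *)
apply: le_lt_trans (lte_add_pinfty sa hs).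
rewrite -esumD; last 2 first.
- by move=> k _; rewrite lee_fin invr_ge0 ltW.
- by move=> k _; rewrite lee_fin mulr_ge0 ?sqr_ge0// powR_ge0.
apply: le_esum => k _; rewrite -EFinD lee_fin.
have : a k <= a k `^ s.
  by rewrite -[leLHS]powRr1 ?(ltW (a0 k))// ler_powR// ltW.
rewrite -/(a k); move: (cmod _) (a k) (a k `^ s) (a0 k) (a1 k) => c x y x0 x1 xy.
apply: (@le_trans _ _ (x^-1 + x * c ^+ 2)); last by rewrite lerD2l ler_wpM2r// sqr_ge0.
rewrite -subr_ge0.
have -> : x^-1 + x * c ^+ 2 - c = x^-1 * ((x * c - 2^-1) ^+ 2 + 3 / 4).
  by field; rewrite gt_eqF.
rewrite mulr_ge0 ?invr_ge0 ?(ltW x0)// addr_ge0 ?sqr_ge0//; lra.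
Qed.

End sobolev.

(** * The algebraic identity behind mass conservation *)

Section mass_identity.
Context {R : realType}.
Implicit Types (u v : R -> R[i]).

Lemma ip_affine (I : finType) (X : I -> R -> R[i]) (r : I -> R) u v :
  L2c u -> L2c v -> (forall i, L2c (X i)) ->
  ip (fun x => u x + \sum_i (r i)%:C * X i x) v = ip u v + \sum_i r i * ip (X i) v.
Proof.
move=> u2 v2 X2; rewrite ipDl//; last by apply: L2c_sum => i; exact: L2cZ.
rewrite ip_suml//; last by move=> i; exact: L2cZ.
by congr (_ + _); apply: eq_bigr => i _; rewrite ipZl.
Qed.

(** Over an abstract index set, so that deterministic and stochastic increments are treated alike
    once their time weights are absorbed into [X]. *)
Lemma ip_conserved (I : finType) (X : I -> R -> R[i]) (b : I -> R)
    (a : I -> I -> R) u :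
  L2c u -> (forall i, L2c (X i)) ->
  (forall i j, b i * b j - b i * a i j - b j * a j i = 0) ->
  (forall i, ip (fun x => u x + \sum_j (a i j)%:C * X j x) (X i) = 0) ->
  let v := fun x => u x + \sum_i (b i)%:C * X i x in ip v v = ip u u.
Proof.
move=> u2 X2 hab hX v.
have v2 : L2c v by apply: L2cD => //; apply: L2c_sum => i; exact: L2cZ.
pose G i j := ip (X i) (X j).
have GC i j : G i j = G j i by exact: ipC.
have uX i : ip u (X i) = - \sum_j a i j * G j i.
  by have /eqP := hX i; rewrite ip_affine// addr_eq0 => /eqP.
rewrite {1}/v ip_affine// ipC {1}/v ip_affine//.
have -> : \sum_i b i * ip (X i) v =
    \sum_i \sum_j (b i * b j * G i j - b i * a i j * G i j).
  apply: eq_bigr => i _; rewrite ipC ip_affine// uX mulrDr mulrN !mulr_sumr.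
  rewrite addrC -sumrB; apply: eq_bigr => j _.
  by rewrite -/(G j i) (GC j i) !mulrA.
have -> : \sum_i b i * ip (X i) u = - \sum_i \sum_j b j * a j i * G i j.
  (* The indices are swapped so that the summand carries [b j * a j i], the second mixed term of the
     coefficient condition. *)
  rewrite [X in - X]exchange_big -sumrN; apply: eq_bigr => i _.
  rewrite ipC uX mulrN mulr_sumr; congr (- _); apply: eq_bigr => j _.
  by rewrite mulrA.
rewrite -addrA; apply/eqP; rewrite addrC -subr_eq0 addrK addrC -sumrB; apply/eqP.
apply: big1 => i _; rewrite -sumrB big1// => j _.
by rewrite -!mulrBl hab mul0r.
Qed.

End mass_identity.

(** * The free Schroedinger evolution: linearity and conservation of mass *)

Section evolution.
Context {R : realType}.
Implicit Types (u v g : R -> R[i]).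

(** Turns the mass assumptions on the discretisation maps into orthogonality for [ip]. *)
Lemma Re_cintegral_ip u g :
  complex.Re (cintegral torus (fun x => (u x)^*%C * g x)) = ip u g.
Proof.
apply: eq_Rintegral => x _; rewrite ReM.
by case: (u x) => p q /=; rewrite mulNr opprK.
Qed.

Lemma torus_measurableZ (z : R[i]) g :
  torus_measurable g -> torus_measurable (fun x => z * g x).
Proof.
move=> [mr mi]; split.
  under eq_fun do rewrite ReM.
  by apply: measurable_funB; exact: measurable_funM.
under eq_fun do rewrite ImM.
by apply: measurable_funD; exact: measurable_funM.
Qed.

(** The class on which [schroedinger] is linear and preserves mass; it is closed under the real
    linear combinations that occur in the scheme. *)
Definition fsummable u := L2c u /\ csummable (fourier u).

Lemma fsummableD u v : fsummable u -> fsummable v ->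
  fsummable (fun x => u x + v x).
Proof.
move=> [u2 us] [v2 vs]; split; first exact: L2cD.
have -> : fourier (fun x => u x + v x) = (fun k => fourier u k + fourier v k).
  by apply/funext => k; rewrite fourierD.
exact: csummableD.
Qed.

Lemma fsummableZ (r : R) u : fsummable u -> fsummable (fun x => r%:C * u x).
Proof.
move=> [u2 us]; split; first exact: L2cZ.
have -> : fourier (fun x => r%:C * u x) = (fun k => r%:C * fourier u k).
  by apply/funext => k; rewrite fourierZ.
exact: csummableZ.
Qed.

Lemma fsummable_sum (I : Type) (r : seq I) (u : I -> R -> R[i]) :
  (forall i, fsummable (u i)) -> fsummable (fun x => \sum_(i <- r) u i x).
Proof.
move=> hu; elim: r => [|i r ih].
  have -> : (fun x => \sum_(i <- [::]) u i x) = (fun=> 0).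
    by apply/funext => x; rewrite big_nil.
  split; first exact: L2c0.
  rewrite /csummable esum1 ?ltry// => k _.
  by rewrite fourierE !ip0l !mulr0 ComplexField.Normc.normc0.
have -> : (fun x => \sum_(j <- i :: r) u j x) =
    (fun x => u i x + \sum_(j <- r) u j x).
  by apply/funext => x; rewrite big_cons.
exact: fsummableD (hu i) ih.
Qed.

Lemma schroedingerD (t : R) u v x : fsummable u -> fsummable v ->
  schroedinger t (fun y => u y + v y) x = schroedinger t u x + schroedinger t v x.
Proof.
move=> [u2 us] [v2 vs]; rewrite /schroedinger.
under eq_fun do rewrite fourierD// mulrDr.
by rewrite fourier_seriesD//; exact: csummable_expi.
Qed.

Lemma schroedingerZ (t r : R) u x : fsummable u ->
  schroedinger t (fun y => r%:C * u y) x = r%:C * schroedinger t u x.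
Proof.
move=> [u2 us]; rewrite /schroedinger.
under eq_fun do rewrite fourierZ// mulrCA.
by rewrite fourier_seriesZ//; exact: csummable_expi.
Qed.

Lemma mass_schroedinger (t : R) u : fsummable u -> mass (schroedinger t u) = mass u.
Proof. by move=> [u2 us]; exact: mass_fourier_multiplier. Qed.

End evolution.

(** * Almost sure events and the pathwise argument *)

Section almost_surely.
Context d {T : measurableType d} {R : realType} (P : probability T R).

Lemma almost_surely_imp (A B : T -> Prop) : (forall x, A x -> B x) ->
  {ae P, forall x, A x} -> {ae P, forall x, B x}.
Proof. by move=> AB; apply: negligibleS => x /= nB nA; exact/nB/AB. Qed.

Lemma almost_surely_and (A B : T -> Prop) :
  {ae P, forall x, A x} -> {ae P, forall x, B x} -> {ae P, forall x, A x /\ B x}.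
Proof.
move=> PA PB; apply: negligibleS (negligibleU PA PB) => x /= /not_andP.
by case; [left|right].
Qed.

End almost_surely.

(** Splits a sum over pairs of a kind and a stage into the deterministic and the stochastic sum of
    the scheme. *)
Lemma sum_two_stages (V : nmodType) (I : finType) (F : 'I_2 * I -> V) :
  \sum_x F x = \sum_i F (ord0, i) + \sum_i F (ord_max, i).
Proof.
transitivity (\sum_j \sum_i F (j, i)).
  by rewrite pair_bigA; apply: eq_bigr => -[].
rewrite big_ord_recl big_ord1; congr (_ + _); apply: eq_bigr => i _.
by congr (F (_, i)); apply: val_inj.
Qed.

Theorem proposition5p3 (R : realType)
  (disp : measure_display) (Omega : measurableType disp) (P : probability Omega R)
  (W : int -> R -> {RV P >-> R}) (HW : brownian_family W)
  (Phi : (R -> R[i]) -> R -> R[i]) (phi : int -> R[i])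
  (HPhi : hilbert_schmidt_diag 2 Phi phi)
  (d : nat) (hd : (1 <= d)%N) (gamma : 'I_d -> R)
  (hgamma01 : forall j, 0 <= gamma j <= 1)
  (hgamma : {homo gamma : i j / (i < j)%N >-> i < j})
  (S : nat) (c : 'I_S.+1 -> R) (hc : forall q, 0 <= c q <= 1)
  (a : 'I_2 -> stage S -> stage S -> R)
  (b : 'I_2 -> stage S -> R)
  (s lambda kappa t : R) (hs : 1 < s) (ht : 0 < t) (n : nat)
  (Hab : forall (al al' : stage S) (i j : 'I_2),
     b i al * b j al' - b i al * a j al al' - b j al' * a i al' al = 0)
  (HF : forall u, HT s u -> forall p q : 'I_S.+1,
     complex.Re (cintegral torus
       (fun x => (u x)^*%C * discF gamma t lambda p (c q) u x)) = 0)
  (HP : {ae P, forall w, forall u, HT s u -> forall p q : 'I_S.+1,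
     complex.Re (cintegral torus
       (fun x => (u x)^*%C *
          discP gamma t (step_noise t n W) phi kappa p (c q) w u x)) = 0})
  (un un1 : Omega -> R -> R[i])
  (U K L : stage S -> Omega -> R -> R[i])
  (Hreg : {ae P, forall w, [/\ HT s (un w), HT s (un1 w) &
     forall al, [/\ HT s (U al w), HT s (K al w) & HT s (L al w)]]})
  (Hun1 : {ae P, forall w, eqT (un1 w) (fun x =>
     schroedinger t (un w) x
     + t%:C * schroedinger t (fun y => \sum_al (b ord0 al)%:C * K al w y) x
     + (Num.sqrt t)%:C *
       schroedinger t (fun y => \sum_al (b ord_max al)%:C * L al w y) x)})
  (HU : {ae P, forall w, forall al, eqT (U al w) (fun x =>
     un w x
     + t%:C * (\sum_al' (a ord0 al al')%:C * K al' w x)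
     + (Num.sqrt t)%:C * (\sum_al' (a ord_max al al')%:C * L al' w x))})
  (HK : {ae P, forall w, forall p q r : 'I_S.+1,
     eqT (K (p, q, r) w) (discF gamma t lambda p (c q) (U (p, q, r) w))})
  (HL : {ae P, forall w, forall p q r : 'I_S.+1,
     eqT (L (p, q, r) w)
       (discP gamma t (step_noise t n W) phi kappa p (c q) w (U (p, q, r) w))}) :
  {ae P, forall w, mass (un1 w) = mass (un w)}.
Proof.
(* All almost sure assumptions hold together on one event of full probability; from here on [w] is
   fixed. *)
have Hall := almost_surely_and (almost_surely_and (almost_surely_and HP Hreg)
  (almost_surely_and Hun1 HU)) (almost_surely_and HK HL).
apply: almost_surely_imp Hall => w [[[hP [hun hun1 hreg]] [hun1E hU]] [hK hL]].
have fs u : HT s u -> fsummable u.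
  by move=> hu; split; [apply: L2T_L2c; case: hu|exact: HT_csummable hu].
pose Y (x : 'I_2 * stage S) := if x.1 == ord0 then K x.2 w else L x.2 w.
pose tau (x : 'I_2 * stage S) := if x.1 == ord0 then t else Num.sqrt t.
pose X x y := (tau x)%:C * Y x y.
have Yfs x : fsummable (Y x).
  by have [_ hKx hLx] := hreg x.2; rewrite /Y; case: ifP => _; exact: fs.
have Xfs x : fsummable (X x) by exact: fsummableZ (Yfs x).
pose V y := un w y + \sum_x (b x.1 x.2)%:C * X x y.
have unfs := fs _ hun.
have Vfs : fsummable V.
  by apply: (fsummableD unfs); apply: fsummable_sum => x; exact: fsummableZ (Xfs x).
(* The scheme evolves its three summands separately; linearity on [fsummable] functions merges them
   into the evolution of [V]. *)
have un1V : eqT (un1 w) (schroedinger t V).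
  apply: ae_torusS hun1E => x h /h ->.
  have VE : V = (fun y => un w y + t%:C * (\sum_al (b ord0 al)%:C * K al w y)
      + (Num.sqrt t)%:C * (\sum_al (b ord_max al)%:C * L al w y)).
    apply/funext => y; rewrite /V sum_two_stages addrA !mulr_sumr.
    by congr (_ + _ + _); apply: eq_bigr => al _; rewrite mulrCA.
  have hK' : fsummable (fun y => \sum_al (b ord0 al)%:C * K al w y).
    apply: fsummable_sum => al; apply: fsummableZ; apply: fs.
    by have [] := hreg al.
  have hL' : fsummable (fun y => \sum_al (b ord_max al)%:C * L al w y).
    apply: fsummable_sum => al; apply: fsummableZ; apply: fs.
    by have [] := hreg al.
  have hKz := fsummableZ t hK'; have hLz := fsummableZ (Num.sqrt t) hL'.
  rewrite VE (schroedingerD _ _ (fsummableD unfs hKz) hLz).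
  by rewrite (schroedingerD _ _ unfs hKz) (schroedingerZ _ _ _ hK') (schroedingerZ _ _ _ hL').
rewrite (mass_ae _ _ un1V); last 2 first.
- by apply: L2c_measurable; exact: (fs _ hun1).1.
- exact: measurable_fourier_series.
rewrite mass_schroedinger// (mass_ip Vfs.1) (mass_ip unfs.1); congr EFin.
(* The coefficient of increment [y] in stage [x] ignores the kind of [x]: both increments of a stage
   are computed from the same [U]. *)
apply: (@ip_conserved _ _ X _ (fun x y => a y.1 x.2 y.2)).
- exact: unfs.1.
- by move=> x; exact: (Xfs x).1.
- by move=> [i al] [j al'] /=; exact: Hab.
move=> [i al].
have [hUal _ _] := hreg al; have U2 := (fs _ hUal).1.
have A2 : L2c (fun y => un w y + \sum_x (a x.1 al x.2)%:C * X x y).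
  apply: L2cD; first exact: unfs.1.
  by apply: L2c_sum => x; apply: L2cZ; exact: (Xfs x).1.
(* The affine combination is the stage up to a null set, so orthogonality is needed only for
   [U al w]. *)
rewrite -(@ip_ae _ (U al w)); first last.
- apply: ae_torusS (hU al) => x h /h ->.
  rewrite sum_two_stages addrA !mulr_sumr.
  by congr (_ + _ + _); apply: eq_bigr => al' _; rewrite mulrCA.
- exact: L2c_measurable (Xfs _).1.
- exact: L2c_measurable A2.
- exact: L2c_measurable U2.
(* The weight [t] or [Num.sqrt t] is pulled out, and the remaining factor is shown to vanish. *)
rewrite ipC ipZl//; last exact: (Yfs _).1.
rewrite ipC; apply/eqP; rewrite mulf_eq0; apply/orP; right; apply/eqP.
move: al hUal U2 {A2} => [[p q] r] hUal U2.
have Ym := L2c_measurable (Yfs (i, (p, q, r))).1.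
(* In either case the increment agrees almost everywhere with the discretisation map at the stage,
   to which the mass assumption applies. *)
move: Ym; rewrite /Y /=; case: ifP => _ Ym.
  rewrite -(HF _ hUal p q) Re_cintegral_ip ipC [RHS]ipC; apply: ip_ae => //.
  - by apply: torus_measurableZ; exact: measurable_fourier_series.
  - exact: L2c_measurable U2.
rewrite -(hP _ hUal p q) Re_cintegral_ip ipC [RHS]ipC; apply: ip_ae => //.
- by apply: torus_measurableZ; exact: measurable_fourier_series.
- exact: L2c_measurable U2.
Qed.
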